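(* Let $0 < d \le 1/2$ be fixed. Then: (1) The threshold for the property $\mathscr{G}_{d,n} \cup \mathbb{G}(n,p) \xrightarrow{\mathrm{rbw}} K_4$ is $n^{-5/4}$. (2) The threshold for the property $\mathscr{G}_{d,n} \cup \mathbb{G}(n,p) \xrightarrow{\mathrm{rbw}} K_5$ is $n^{-1}$. (3) The threshold for the property $\mathscr{G}_{d,n} \cup \mathbb{G}(n,p) \xrightarrow{\mathrm{rbw}} K_7$ is $n^{-7/15}$. Explicitly, for $(\ell,\hat p) \in \{(4,n^{-5/4}),(5,n^{-1}),(7,n^{-7/15})\}$: if $p=\omega(\hat p)$ then for every sequence $(G_n)$ with $G_n\in\mathscr{G}_{d,n}$ we have $\Pr[G_n\cup\mathbb{G}(n,p)\xrightarrow{\mathrm{rbw}} K_\ell]\to 1$; and if $p=o(\hat p)$ then there exists a sequence $(G_n)$ with $G_n\in\mathscr{G}_{d,n}$ such that $\Pr[G_n\cup\mathbb{G}(n,p)\xrightarrow{\mathrm{rbw}} K_\ell]\to 0$.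
   Context: For graphs $G,H$, write $G \xrightarrow{\mathrm{rbw}} H$ if every proper edge-colouring of $G$ contains a rainbow copy of $H$ (a subgraph all of whose edges receive distinct colours). $\mathbb{G}(n,p)$ is the binomial random graph. $\mathscr{G}_{d,n}$ denotes the family of $n$-vertex graphs with edge density at least $d$ (at least $d\binom n2$ edges). $G\cup\mathbb{G}(n,p)$ denotes the union of a fixed $n$-vertex graph $G$ with an independent random graph $\mathbb{G}(n,p)$ on the same vertex set. A sequence $\hat p(n)$ is a threshold for a property $\mathcal P$ in this perturbed model if (a) whenever $p=\omega(\hat p)$, for every sequence $G_n\in\mathscr{G}_{d,n}$, $G_n\cup\mathbb{G}(n,p)\in\mathcal P$ with probability tending to $1$, and (b) whenever $p=o(\hat p)$, there exists a sequence $G_n\in\mathscr{G}_{d,n}$ with $\Pr[G_n\cup\mathbb{G}(n,p)\in\mathcal P]\to 0$. *)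

(* Defs.v *)
From HB Require Import structures.
From mathcomp Require Import all_boot all_order all_algebra.
From mathcomp Require Import all_classical all_reals all_analysis.
Set Implicit Arguments. Unset Strict Implicit. Unset Printing Implicit Defensive.
Import Order.TTheory GRing.Theory Num.Theory.
Import numFieldNormedType.Exports.
Local Open Scope ring_scope.

Definition all_edges (n : nat) : {set {set 'I_n}} := [set e : {set 'I_n} | #|e| == 2%N].

Definition is_graph (n : nat) (G : {set {set 'I_n}}) : bool :=
  G \subset all_edges n.

Definition in_dense_family (R : realType) (d : R) (n : nat)
    (G : {set {set 'I_n}}) : Prop :=
  is_graph G /\ d * ('C(n, 2))%:R <= (#|G|)%:R.

Definition proper_colouring (n : nat) (H : {set {set 'I_n}})
    (c : {set 'I_n} -> nat) : Prop :=
  forall e1 e2, e1 \in H -> e2 \in H -> e1 != e2 ->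
    e1 :&: e2 != finset.set0 -> c e1 != c e2.

Definition has_rainbow_clique (n l : nat) (H : {set {set 'I_n}})
    (c : {set 'I_n} -> nat) : Prop :=
  exists f : 'I_l -> 'I_n, injective f /\
    (forall i j, i != j -> [set f i; f j] \in H) /\
    (forall i j i' j', i != j -> i' != j' ->
       [set f i; f j] != [set f i'; f j'] ->
       c [set f i; f j] != c [set f i'; f j']).

Definition rbw_arrow (n l : nat) (H : {set {set 'I_n}}) : Prop :=
  forall c : {set 'I_n} -> nat, proper_colouring H c -> has_rainbow_clique l H c.

(* Pr[ G ∪ G(n,p) ∈ P ]: each of the binom(n,2) possible edges is present in
   the random graph independently with probability p. *)
Definition prob_perturbed (R : realType) (n : nat) (G : {set {set 'I_n}})
    (p : R) (P : {set {set 'I_n}} -> Prop) : R :=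
  \sum_(E in powerset (all_edges n))
     (if `[< P (G :|: E) >] then p ^+ #|E| * (1 - p) ^+ (#|all_edges n| - #|E|)
      else 0).

Definition is_prob_seq (R : realType) (p : nat -> R) : Prop :=
  forall n, 0 <= p n <= 1.

Local Open Scope classical_set_scope.
Local Open Scope ring_scope.

Definition rbw_threshold (R : realType) (d : R) (l : nat) (phat : nat -> R) : Prop :=
  (forall p : nat -> R, is_prob_seq p ->
     (fun n => p n / phat n) @ \oo --> +oo ->
     forall G : forall n, {set {set 'I_n}},
       (forall n, in_dense_family d (G n)) ->
       (fun n => prob_perturbed (G n) (p n) (@rbw_arrow n l)) @ \oo --> (1 : R))
  /\
  (forall p : nat -> R, is_prob_seq p ->
     (fun n => p n / phat n) @ \oo --> (0 : R) ->
     exists G : forall n, {set {set 'I_n}},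
       (forall n, in_dense_family d (G n)) /\
       (fun n => prob_perturbed (G n) (p n) (@rbw_arrow n l)) @ \oo --> (0 : R)).

(* Main.v *)
(** Lower bounds on the probability come from a second moment argument.  By
    convexity a dense graph [G_n] contains a positive proportion of all possible
    copies of a fixed complete bipartite graph, and for suitable graphs [F_A],
    [F_B] on its two classes the random graph completes one of these copies as
    soon as [n^v p^e] tends to infinity for all subgraphs of [F_A + F_B].  The
    pieces are two stars K_{1,4} for K_4 (of the 16 pairs of edges only 12 can be
    spoiled by repeated colours), a triangle and a tree of depth two for K_5, and
    K_3 joined to four independent vertices (which forces a rainbow K_4) together
    with a tree-like union of triangles for K_7.  The last two give rainbow
    cliques greedily: a rainbow clique with many common neighbours extends.

    For the upper bounds [G_n] is the balanced complete bipartite graph, and the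
    first moment method shows that every bounded set of vertices spans few random
    edges.  For K_5 there is then no triangle inside a class.  For K_4 the random
    graph splits into trees with at most three edges, and an explicit colouring of
    the K_{4,4} between two of them spoils every K_4.  For K_7 it suffices to
    colour the random graph properly without a rainbow K_4: its K_4s fall into
    edge-disjoint clusters obtained by gluing at most four K_4s, and each cluster
    is coloured by giving two opposite edges of each K_4 the same colour. *)

Require Import Defs.
From mathcomp Require Import all_boot all_order all_algebra.
From mathcomp Require Import zify ring lra.
Set Implicit Arguments. Unset Strict Implicit. Unset Printing Implicit Defensive.
Import Order.TTheory GRing.Theory Num.Theory.
Local Open Scope ring_scope.

(** * Moments of the random edge set *)

(** The exponents are the vertex-to-edge ratios of the critical random subgraphs: 5/4 for K_{1,4},
    3/3 for the triangle, 7/15 for K_3 joined to four independent vertices. The other vertices of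
    the pieces send back at most one edge (K_5) or two edges (K_7), so they never exceed the
    critical density and can be multiplied until the greedy choices succeed.

    Density is always compared through integers, [s * edges] against [r * vertices], for the
    threshold n^(-s/r). Writing p = n^(-s/r) L, the same comparison read in opposite directions
    gives n^v p^e >= L for L >= 1 and n^v p^e <= L for L <= 1, as soon as e >= 1. The critical
    density itself is therefore forbidden below the threshold.

    The delicate part is the zero statement for K_7. Few K_4s can be glued together, but a colour
    repeated for one K_4 may prevent a repetition in the next. Only colours already repeated can do
    so, which is why their number is tracked together with the density. *)

Definition wt (R : realFieldType) (T : finType) (N : {set T}) (p : R) (E : {set T}) : R :=
  p ^+ #|E| * (1 - p) ^+ (#|N| - #|E|).

Lemma wt_ge0 (R : realFieldType) (T : finType) (N : {set T}) (p : R) (E : {set T}) :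
  0 <= p <= 1 -> 0 <= wt N p E.
Proof. by case/andP=> p0 p1; rewrite mulr_ge0 // exprn_ge0 // subr_ge0. Qed.

Lemma sum_wt_superset (R : realFieldType) (T : finType) (N S : {set T}) (p : R) :
  S \subset N ->
  \sum_(E in powerset N) (if S \subset E then wt N p E else 0) = p ^+ #|S|.
Proof.
move=> SN.
(* Weights of [i] when chosen and when omitted. A chosen element outside [N] and an omitted element
   of [S] weigh zero, so expanding the product keeps exactly the sets between [S] and [N]. *)
pose F i : R := if i \in N then p else 0.
pose H i : R := if i \in N then (if i \in S then 0 else 1 - p) else 1.
have -> : p ^+ #|S| = \prod_i (F i + H i).
  rewrite (bigID (mem S)) /= [X in _ * X]big1 ?mulr1 => [|i iS].
    rewrite (eq_bigr (fun=> p)) ?prodr_const // => i iS.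
    by rewrite /F /H (subsetP SN _ iS) iS addr0.
  by rewrite /F /H (negPf iS); case: ifP => _; ring.
rewrite bigA_distr [LHS]big_mkcond /=; apply: eq_bigr => E _.
rewrite powersetE; case: ifPn => [EN|/subsetPn[i iE iN]]; last first.
  by rewrite (bigD1 i) //= iE /F (negPf iN) mul0r.
case: ifPn => [SE|/subsetPn[i iS iE]]; last first.
  by rewrite (bigD1 i) //= (negPf iE) /H iS (subsetP SN _ iS) mul0r.
rewrite /wt -cardsDS // (bigID (mem E)) /=; congr (_ * _).
  rewrite (eq_bigr (fun=> p)) ?prodr_const // => i iE.
  by rewrite iE /F (subsetP EN).
rewrite (bigID (mem N)) /= [X in _ * X]big1 ?mulr1.
  rewrite (eq_bigr (fun=> 1 - p)) => [|i /andP[iE iN]].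
    by rewrite prodr_const; congr (_ ^+ _); apply: eq_card => i; rewrite !inE.
  by rewrite (negPf iE) /H iN; case: ifP => // iS; rewrite (subsetP SE) in iE.
by move=> i /andP[iE iN]; rewrite (negPf iE) /H (negPf iN).
Qed.

Lemma sum_wt (R : realFieldType) (T : finType) (N : {set T}) (p : R) :
  \sum_(E in powerset N) wt N p E = 1.
Proof.
rewrite -[RHS](expr0 p) -(cards0 T) -(sum_wt_superset p (sub0set N)).
by apply: eq_bigr => E _; rewrite sub0set.
Qed.

(** The union bound over the events [S i \subset E], each of probability [p ^+ #|S i|]. *)
Lemma first_moment (R : realFieldType) (T I : finType) (N : {set T}) (p : R)
    (D : pred I) (S : I -> {set T}) (P : pred {set T}) :
  0 <= p <= 1 -> (forall i, D i -> S i \subset N) ->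
  (forall E : {set T}, E \subset N -> P E -> exists2 i, D i & S i \subset E) ->
  \sum_(E in powerset N | P E) wt N p E <= \sum_(i | D i) p ^+ #|S i|.
Proof.
move=> p01 SN PS.
under [leRHS]eq_bigr => i Di do rewrite -(sum_wt_superset p (SN i Di)).
rewrite exchange_big big_mkcondr /=; apply: ler_sum => E EN.
case: ifP => [PE|_]; last by apply: sumr_ge0 => i _; case: ifP => // _; rewrite wt_ge0.
have [|i Di SiE] := PS E _ PE; first by rewrite -powersetE.
rewrite (bigD1 i) //= SiE lerDl; apply: sumr_ge0 => j _.
by case: ifP => // _; rewrite wt_ge0.
Qed.

(** Chebyshev's inequality without division. The number [X] of sets [S i] inside [E] vanishes where
    [P] fails, so [(X - mu) ^+ 2] equals [mu ^+ 2] there; the right-hand side is the variance of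
    [X]. *)
Lemma second_moment (R : realFieldType) (T I : finType) (N : {set T}) (p : R)
    (D : {set I}) (S : I -> {set T}) (P : pred {set T}) (mu := \sum_(i in D) p ^+ #|S i|) :
  0 <= p <= 1 -> (forall i, i \in D -> S i \subset N) ->
  (forall (E : {set T}) i, E \subset N -> i \in D -> S i \subset E -> P E) ->
  mu ^+ 2 * (\sum_(E in powerset N | ~~ P E) wt N p E)
    <= \sum_(i in D) \sum_(j in D) p ^+ #|S i :|: S j| - mu ^+ 2.
Proof.
move=> p01 SN PS.
pose X (E : {set T}) : R := \sum_(i in D) (S i \subset E)%:R.
have mulsub (E A : {set T}) : wt N p E * (A \subset E)%:R = if A \subset E then wt N p E else 0.
  by case: ifP; rewrite ?mulr1 ?mulr0.
have EX : \sum_(E in powerset N) wt N p E * X E = mu.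
  under eq_bigr => E _ do rewrite mulr_sumr.
  rewrite exchange_big; apply: eq_bigr => i Di.
  by rewrite -(sum_wt_superset p (SN i Di)); apply: eq_bigr => E _; rewrite mulsub.
have EX2 : \sum_(E in powerset N) wt N p E * X E ^+ 2
    = \sum_(i in D) \sum_(j in D) p ^+ #|S i :|: S j|.
  under eq_bigr => E _ do rewrite expr2 {1}/X mulr_suml mulr_sumr.
  rewrite exchange_big; apply: eq_bigr => i Di.
  under eq_bigr => E _ do rewrite mulr_sumr mulr_sumr.
  rewrite exchange_big; apply: eq_bigr => j Dj.
  have SijN : S i :|: S j \subset N by rewrite subUset !SN.
  rewrite -(sum_wt_superset p SijN); apply: eq_bigr => E _.
  by rewrite -mulsub subUset -natrM mulnb.
have -> : \sum_(i in D) \sum_(j in D) p ^+ #|S i :|: S j| - mu ^+ 2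
    = \sum_(E in powerset N) wt N p E * (X E - mu) ^+ 2.
  transitivity (\sum_(E in powerset N)
    (wt N p E * X E ^+ 2 - mu *+ 2 * (wt N p E * X E) + mu ^+ 2 * wt N p E)).
    by rewrite !big_split /= sumrN -!mulr_sumr EX2 EX sum_wt; ring.
  by apply: eq_bigr => E _; ring.
rewrite mulr_sumr big_mkcondr; apply: ler_sum => E; rewrite powersetE => EN.
case: ifP => [nP|_]; last by rewrite mulr_ge0 ?wt_ge0 // sqr_ge0.
rewrite /X big1 ?sub0r ?sqrrN 1?mulrC // => i Di.
by case: (boolP (S i \subset E)) => // /(PS E i EN Di); rewrite (negPf nP).
Qed.

(** * Copies of a fixed graph in the random graph *)

Definition copy (V T : finType) (F : {set {set V}}) (f : {ffun V -> T}) : {set {set T}} :=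
  [set f @: e | e : {set V} in F].

Definition edges_in (V : finType) (F : {set {set V}}) (J : {set V}) : {set {set V}} :=
  [set e in F | e \subset J].

Lemma card_copy (V T : finType) (F : {set {set V}}) (f : {ffun V -> T}) :
  injective f -> #|copy F f| = #|F|.
Proof. by move=> injf; rewrite card_imset //; apply: imset_inj. Qed.

(** A common edge has its ends in both images, hence comes from an edge of [F] inside the overlap
    pulled back along [f]. *)
Lemma card_copyI (V T : finType) (F : {set {set V}}) (f g : {ffun V -> T}) :
  (#|copy F f :&: copy F g| <= #|edges_in F (f @^-1: (g @: setT))|)%N.
Proof.
apply: leq_trans (leq_imset_card (fun e : {set V} => f @: e) _).
apply: subset_leq_card; apply/subsetP=> e /setIP[/imsetP[e1 Fe1 ->] /imsetP[e2 _ fe]].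
apply/imsetP; exists e1 => //; rewrite inE Fe1; apply/subsetP=> x xe.
by rewrite inE (subsetP (imsetS g (subsetT e2))) // -fe imset_f.
Qed.

(** The sum factorises over the vertices: a vertex sent into the image of [g] has at most [#|V|]
    choices of weight [#|T|], and any other has at most [#|T|] choices of weight 1. *)
Lemma sum_expn_common (V T : finType) (g : {ffun V -> T}) :
  (\sum_(f : {ffun V -> T}) #|T| ^ #|f @^-1: (g @: setT)| <= (#|T| * #|V|.+1) ^ #|V|)%N.
Proof.
have -> : (\sum_(f : {ffun V -> T}) #|T| ^ #|f @^-1: (g @: setT)| =
    \prod_(i : V) \sum_(x : T) (if x \in g @: setT then #|T| else 1))%N.
  rewrite bigA_distr_bigA; apply: eq_bigr => f _ /=.
  rewrite -big_mkcond prod_nat_const /=; congr (_ ^ _)%N.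
  by apply: eq_card => x; rewrite !inE.
apply: (@leq_trans (\prod_(i : V) (#|T| * #|V|.+1))); last by rewrite prod_nat_const.
apply: leq_prod => _ _; rewrite (bigID (mem (g @: setT))) /= mulnS addnC leq_add //.
  rewrite (eq_bigr (fun=> 1%N)) => [|x /negPf ->] //.
  by rewrite sum1_card max_card.
rewrite (eq_bigr (fun=> #|T|)) => [|x ->] //.
by rewrite sum_nat_const mulnC leq_mul // (leq_trans (leq_imset_card _ _)) ?max_card.
Qed.

(** [L] is a lower bound for the expected number of copies of every subgraph with an edge.
    Edge-disjoint pairs are paid for by the summand [L]; for the others, counting the shared edges
    only once is paid for by the power of [#|T|]. *)
Lemma pair_weight_le (R : realFieldType) (V T : finType) (F : {set {set V}})
    (f g : {ffun V -> T}) (p L : R) :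
  0 <= p <= 1 -> 0 <= L -> injective f -> injective g ->
  (forall J, (0 < #|edges_in F J|)%N -> L <= #|T|%:R ^+ #|J| * p ^+ #|edges_in F J|) ->
  p ^+ #|copy F f :|: copy F g| * L
    <= p ^+ #|F| ^+ 2 * (L + #|T|%:R ^+ #|f @^-1: (g @: setT)|).
Proof.
move=> /andP[p0 p1] L0 injf injg hL.
set J := f @^-1: _; have cI : (_ <= #|edges_in F J|)%N := card_copyI F f g.
have eJF : (#|edges_in F J| <= #|F|)%N.
  by apply: subset_leq_card; apply/subsetP=> e; rewrite inE => /andP[].
rewrite cardsU !card_copy // mulrDr -exprM muln2 -addnn.
set c := #|_ :&: _| in cI *; set e := #|edges_in F J| in cI eJF *.
have [c0|c0] := posnP c.
  by rewrite c0 subn0 lerDl mulr_ge0 ?exprn_ge0.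
(* As [p <= 1], the [c] shared edges may be replaced by all [e >= c] edges of [F] inside [J]. *)
apply: le_trans (_ : p ^+ (#|F| + #|F| - e) * (#|T|%:R ^+ #|J| * p ^+ e) <= _).
  apply: ler_pM; rewrite ?exprn_ge0 //; last by apply: hL; lia.
  by apply: ler_wiXn2l => //; lia.
rewrite mulrCA mulrC -exprD subnK; last by lia.
by rewrite [in leRHS]addrC lerDl mulr_ge0 ?exprn_ge0.
Qed.

(** [D] contains a proportion [delta] of all maps, which bounds the mean from below, while the
    overlaps are summed over all maps, injective or not. This costs only the constant
    [#|V|.+1 ^ #|V|]. *)
Lemma copies_second_moment (R : realFieldType) (V T : finType) (N : {set {set T}})
    (F : {set {set V}}) (D : {set {ffun V -> T}}) (P : pred {set {set T}}) (p L delta : R) :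
  0 < p <= 1 -> 0 <= L -> (0 < #|T|)%N ->
  (forall f, f \in D -> injective f /\ copy F f \subset N) ->
  (forall (E : {set {set T}}) f, E \subset N -> f \in D -> copy F f \subset E -> P E) ->
  (forall J, (0 < #|edges_in F J|)%N -> L <= #|T|%:R ^+ #|J| * p ^+ #|edges_in F J|) ->
  0 <= delta -> delta * #|T|%:R ^+ #|V| <= #|D|%:R ->
  delta ^+ 2 * L * (\sum_(E in powerset N | ~~ P E) wt N p E) <= #|V|.+1%:R ^+ #|V|.
Proof.
move=> /andP[p0 p1] L0 T0 HD HP hL d0 hd.
have p01 : 0 <= p <= 1 by rewrite ltW.
set Pr := \sum_(E in powerset N | ~~ P E) wt N p E.
have Pr0 : 0 <= Pr by apply: sumr_ge0 => E _; apply: wt_ge0.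
have := second_moment (N := N) (D := D) (S := copy F) (P := P) p01
  (fun f fD => (HD f fD).2) HP.
rewrite (eq_bigr (fun=> p ^+ #|F|)) => [|f fD]; last by rewrite card_copy //; case: (HD f fD).
rewrite sumr_const -/Pr.
set S := \sum_(i in D) _ => hS.
have hSL : S * L <= p ^+ #|F| ^+ 2 * (#|D|%:R ^+ 2 * L + #|V|.+1%:R ^+ #|V| * (#|T|%:R ^+ #|V|) ^+
  2).
  rewrite /S mulr_suml.
  apply: le_trans (_ : \sum_(f in D) \sum_(g in D) p ^+ #|F| ^+ 2 * (L + #|T|%:R ^+ #|f @^-1: (g
    @: setT)|) <= _).
    apply: ler_sum => f fD; rewrite mulr_suml; apply: ler_sum => g gD.
    by apply: pair_weight_le => //; case: (HD _ fD); case: (HD _ gD).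
  under eq_bigr => f _ do rewrite -mulr_sumr big_split /= sumr_const.
  rewrite -mulr_sumr big_split /= sumr_const; apply: ler_wpM2l; first by rewrite !exprn_ge0 // ltW.
  apply: lerD; first by rewrite -[leLHS]mulr_natl -[L *+ _]mulr_natl mulrA expr2.
  rewrite exchange_big /=.
  apply: le_trans (_ : \sum_(g : {ffun V -> T}) (\sum_(f : {ffun V -> T}) #|T| ^ #|f @^-1: (g @:
    setT)|)%:R <= _).
    rewrite [leRHS](bigID (mem D)) /= -[leLHS]addr0 lerD //; last by apply: sumr_ge0.
    apply: ler_sum => g _; rewrite natr_sum [leRHS](bigID (mem D)) /= -[leLHS]addr0 lerD //.
      by under [leRHS]eq_bigr => f _ do rewrite natrX.
    by apply: sumr_ge0.
  apply: le_trans (_ : \sum_(g : {ffun V -> T}) ((#|T| * #|V|.+1) ^ #|V|)%:R <= _).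
    by apply: ler_sum => g _; rewrite ler_nat sum_expn_common.
  by rewrite sumr_const card_ffun -[leLHS]mulr_natl -!natrX -!natrM ler_nat expnMn -[(_ ^
    2)%N]mulnn mulnA [leqLHS]mulnC.
have pe : 0 < p ^+ #|F| ^+ 2 by rewrite !exprn_gt0.
have key : #|D|%:R ^+ 2 * Pr * L <= #|V|.+1%:R ^+ #|V| * (#|T|%:R ^+ #|V|) ^+ 2.
  rewrite -(ler_pM2l pe).
  have := ler_wpM2r L0 hS; rewrite -[_ *+ #|D|]mulr_natl exprMn => h.
  set q := p ^+ #|F| ^+ 2 in hSL h *.
  have -> : q * (#|D|%:R ^+ 2 * Pr * L) = #|D|%:R ^+ 2 * q * Pr * L by ring.
  apply: le_trans h _; rewrite mulrBl lerBlDr; apply: le_trans hSL _.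
  by rewrite le_eqVlt; apply/orP; left; apply/eqP; ring.
have t0 : 0 < (#|T|%:R ^+ #|V|) ^+ 2 :> R by rewrite !exprn_gt0 ?ltr0n.
rewrite -(ler_pM2r t0); apply: le_trans key.
rewrite (_ : _ * _ * _ * _ = (delta * #|T|%:R ^+ #|V|) ^+ 2 * (Pr * L)); last by ring.
rewrite -[leRHS]mulrA; apply: ler_wpM2r; first by rewrite mulr_ge0.
by rewrite ler_sqr // nnegrE ?mulr_ge0 ?exprn_ge0.
Qed.

(** The violated case [s * e >= r * v] is the one where n^v p^e tends to 0 for p = o(n^(-s/r)),
    equality included. The empty set would violate the strict inequality, so it is left out. *)
Definition sparse (T : finType) (s r K : nat) (E : {set {set T}}) : bool :=
  [forall S : {set T}, (0 < #|S| <= K)%N ==> (s * #|edges_in E S| < r * #|S|)%N].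

Lemma bin_leq_expn n k : ('C(n, k) <= n ^ k)%N.
Proof.
apply: leq_trans (_ : n ^_ k <= _)%N; first by rewrite -bin_ffact leq_pmulr ?fact_gt0.
elim: k n => [|k IH] n //; case: n => [|n] //.
rewrite ffactnS expnS leq_mul // (leq_trans (IH n)) //.
by case: k {IH} => // k; rewrite leq_exp2r.
Qed.

(** A violation is witnessed by a vertex set together with its edges. There are at most [#|T| ^ k]
    sets of size [k], each with at most [2 ^ (2 ^ K)] edge sets, and each witness has probability at
    most [L / #|T| ^ k]; the factor [K.+1] counts the sizes. *)
Lemma sparse_first_moment (R : realFieldType) (T : finType) (N : {set {set T}})
    (p L : R) (s r K : nat) :
  0 <= p <= 1 -> 0 <= L -> (0 < #|T|)%N ->
  (forall k m, (0 < k <= K)%N -> (r * k <= s * m)%N -> #|T|%:R ^+ k * p ^+ m <= L) ->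
  \sum_(E in powerset N | ~~ sparse s r K E) wt N p E <= (K.+1 * 2 ^ (2 ^ K))%:R * L.
Proof.
move=> p01 L0 T0 hL.
have t0 : 0 < #|T|%:R :> R by rewrite ltr0n.
pose D (i : {set T} * {set {set T}}) := [&& (0 < #|i.1| <= K)%N,
  i.2 \subset N :&: powerset i.1 & (r * #|i.1| <= s * #|i.2|)%N].
apply: le_trans (first_moment (D := D) (S := snd) p01 _ _) _.
- by case=> S E /and3P[_ /= /subsetIP[]].
- move=> E EN /forallPn[S]; rewrite negb_imply -leqNgt => /andP[cS cE].
  exists (S, edges_in E S); last by apply/subsetP=> e; rewrite inE => /andP[].
  rewrite /D /= cS cE andbT /=; apply/subsetP=> e.
  by rewrite !inE => /andP[/(subsetP EN) -> ->].
apply: le_trans (_ : \sum_(i | D i) L / #|T|%:R ^+ #|i.1| <= _).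
  apply: ler_sum => -[S E] /and3P[/= cS _ cE].
  by rewrite ler_pdivlMr ?exprn_gt0 // mulrC hL.
rewrite -(pair_big_dep (fun S : {set T} => 0 < #|S| <= K)%N
  (fun (S : {set T}) (E : {set {set T}}) => (E \subset N :&: powerset S) && (r * #|S| <= s *
    #|E|)%N)
  (fun (S : {set T}) _ => L / #|T|%:R ^+ #|S|)) /=.
apply: le_trans (_ : \sum_(S : {set T} | (0 < #|S| <= K)%N) (2 ^ (2 ^ K))%:R * (L / #|T|%:R ^+
  #|S|) <= _).
  apply: ler_sum => S /andP[_ cS]; rewrite sumr_const -[leLHS]mulr_natl.
  apply: ler_wpM2r; first by rewrite divr_ge0 ?exprn_ge0.
  rewrite ler_nat; apply: leq_trans (_ : #|powerset (powerset S)| <= _)%N.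
    apply: subset_leq_card; apply/subsetP=> E; rewrite unfold_in => /andP[/subsetIP[_ ES] _].
    by rewrite powersetE.
  by rewrite !card_powerset !leq_exp2l.
rewrite -mulr_sumr natrM [X in _ <= X * _]mulrC -mulrA; apply: ler_wpM2l => //.
rewrite (partition_big (fun S : {set T} => inord #|S| : 'I_K.+1) xpredT) //=.
apply: le_trans (_ : \sum_(k < K.+1) L <= _); last by rewrite sumr_const card_ord mulr_natl.
apply: ler_sum => k _.
rewrite (eq_bigr (fun=> L / #|T|%:R ^+ k)) => [|S /andP[/andP[_ cS] /eqP <-]]; last first.
  by rewrite inordK.
rewrite sumr_const -[leLHS]mulr_natr mulrAC ler_pdivrMr ?exprn_gt0 // ler_wpM2l //.
rewrite -natrX ler_nat; apply: leq_trans (bin_leq_expn _ _).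
rewrite -cardsT -cards_draws; apply: subset_leq_card; apply/subsetP=> S.
rewrite unfold_in inE subsetT => /andP[/andP[_ cS] /eqP kS] /=.
by rewrite -kS inordK.
Qed.

(** * Supersaturation of complete bipartite graphs *)

(** Chebyshev's sum inequality: (a - b)(a^k - b^k) >= 0, added over all pairs of values. *)
Lemma chebyshev_sum (I : finType) (x : I -> nat) k :
  ((\sum_i x i) * (\sum_i x i ^ k) <= #|I| * \sum_i x i ^ k.+1)%N.
Proof.
have swap (a b : nat) : (a * b ^ k + b * a ^ k <= a ^ k.+1 + b ^ k.+1)%N.
  wlog ab : a b / (a <= b)%N.
    by move=> W; case/orP: (leq_total a b) => /W //; rewrite addnC [leqRHS]addnC.
  have : (a ^ k <= b ^ k)%N by case: k => // k; rewrite leq_exp2r.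
  rewrite !expnS; move: (a ^ k)%N (b ^ k)%N => u v uv.
  by rewrite -(subnK ab) -(subnK uv); nia.
have -> : ((\sum_i x i) * (\sum_i x i ^ k) = \sum_i \sum_j x i * x j ^ k)%N.
  by rewrite big_distrl /=; apply: eq_bigr => i _; rewrite big_distrr.
rewrite -(leq_pmul2l (isT : (0 < 2)%N)) mul2n -addnn {2}exchange_big -big_split /=.
under eq_bigr => i _ do rewrite -big_split /=.
apply: (@leq_trans (\sum_i \sum_j (x i ^ k.+1 + x j ^ k.+1))).
  by apply: leq_sum => i _; apply: leq_sum => j _; rewrite swap.
under eq_bigr => i _ do rewrite big_split /= sum_nat_const.
rewrite big_split /= sum_nat_const -big_distrr /= mul2n -addnn; exact: leqnn.
Qed.

(** Jensen's inequality for the power [k], cleared of denominators. *)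
Lemma power_mean (I : finType) (x : I -> nat) k :
  ((\sum_i x i) ^ k * #|I| <= #|I| ^ k * \sum_i x i ^ k)%N.
Proof.
elim: k => [|k IH]; first by rewrite !mul1n; under eq_bigr do rewrite expn0; rewrite sum1_card.
rewrite !expnS -mulnA (leq_trans (leq_mul (leqnn _) IH)) //.
by rewrite mulnCA -mulnA [leqRHS]mulnCA leq_mul // chebyshev_sum.
Qed.

Definition homs (A B T : finType) (adj : rel T) : {set {ffun A + B -> T}} :=
  [set f : {ffun A + B -> T} | [forall a, forall b, adj (f (inl a)) (f (inr b))]].

(** Once [A] is placed, the vertices of [B] are placed independently of each other among the common
    neighbours. *)
Lemma card_homs_ge (A B T : finType) (adj : rel T) :
  (\sum_(x : {ffun A -> T}) #|[pred v | [forall a, adj (x a) v]]| ^ #|B| <= #|homs A B adj|)%N.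
Proof.
pose ff (xy : {ffun A -> T} * {ffun B -> T}) : {ffun A + B -> T} :=
  [ffun v => match v with inl a => xy.1 a | inr b => xy.2 b end].
have ff_inj : injective ff.
  move=> [x y] [x' y'] /ffunP e; congr (_, _); apply/ffunP => i.
    by have := e (inl i); rewrite !ffunE.
  by have := e (inr i); rewrite !ffunE.
apply: (@leq_trans (\sum_(x : {ffun A -> T}) \sum_(y : {ffun B -> T} | y \in ffun_on [pred v |
  [forall a, adj (x a) v]]) 1)).
  by apply: leq_sum => x _; rewrite sum1_card card_ffun_on.
rewrite pair_big_dep /= sum1_card -(card_imset _ ff_inj); apply: subset_leq_card.
apply/subsetP=> _ /imsetP[[x y] xy ->]; move: xy; rewrite unfold_in /= => /ffun_onP yx.
rewrite inE; apply/forallP=> a; apply/forallP=> b; rewrite !ffunE /=.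
by have := yx b; rewrite inE => /forallP.
Qed.

Lemma sum_codegree (A T : finType) (adj : rel T) :
  (\sum_(x : {ffun A -> T}) #|[pred v | [forall a, adj (x a) v]]|
    = \sum_v #|[pred u | adj u v]| ^ #|A|)%N.
Proof.
transitivity (\sum_(x : {ffun A -> T}) \sum_v [forall a, adj (x a) v])%N.
  by apply: eq_bigr => x _; rewrite -sum1_card big_mkcond; apply: eq_bigr => v _; rewrite inE;
    case: [forall _, _].
rewrite exchange_big /=; apply: eq_bigr => v _.
rewrite -card_ffun_on -sum1_card [RHS]big_mkcond /=; apply: eq_bigr => x _.
by rewrite (_ : (x \in _) = [forall a, adj (x a) v]);
  [case: [forall _, _] | apply/ffun_onP/forallP].
Qed.

(** For fixed [i != j], overwriting the value at [i] loses no information on a map with [f i = f j],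
    so these maps are at most a fraction [1 / #|T|] of all maps. *)
Lemma card_noninj_le (V T : finType) :
  (#|T| * #|[set f : {ffun V -> T} | ~~ injectiveb f]| <= #|V| ^ 2 * #|T| ^ #|V|)%N.
Proof.
have pairs (i j : V) : i != j ->
    (#|T| * #|[set f : {ffun V -> T} | f i == f j]| <= #|T| ^ #|V|)%N.
  move=> ij; rewrite -card_ffun -cardsT -cardsX.
  pose up (tf : T * {ffun V -> T}) : {ffun V -> T} :=
    [ffun k => if k == i then tf.1 else tf.2 k].
  rewrite -(@card_in_imset _ _ up) ?max_card // => -[t f] [t' f'].
  rewrite !inE /= => /eqP fij /eqP fij' /ffunP e; congr (_, _).
    by have := e i; rewrite !ffunE eqxx.
  have fe k : k != i -> f k = f' k by move=> ki; have := e k; rewrite !ffunE (negPf ki).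
  apply/ffunP => k; case: (eqVneq k i) => [->|/fe //].
  by rewrite fij fij' fe // eq_sym.
apply: leq_trans (_ : #|T| * \sum_(ij : V * V | ij.1 != ij.2) #|[set f : {ffun V -> T} | f ij.1 ==
  f ij.2]| <= _)%N.
  rewrite leq_mul //;
  apply: leq_trans (_ : #|\bigcup_(ij : V * V | ij.1 != ij.2) [set f : {ffun V -> T} | f ij.1 == f
    ij.2]| <= _)%N.
    apply: subset_leq_card; apply/subsetP=> f; rewrite inE => /injectivePn[i [j ij fij]].
    by apply/bigcupP; exists (i, j) => //; rewrite inE fij.
  elim/big_rec2: _ => [|ij m S _ IH]; first by rewrite cards0.
  by rewrite (leq_trans (leq_card_setU _ _)) // leq_add2l.
rewrite big_distrr /=; apply: leq_trans (_ : \sum_(ij : V * V | ij.1 != ij.2) #|T| ^ #|V| <= _)%N.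
  by apply: leq_sum => -[i j] /pairs.
rewrite sum_nat_const leq_mul // expnS expn1 -card_prod max_card //.
Qed.

Definition inj_homs (A B T : finType) (adj : rel T) : {set {ffun A + B -> T}} :=
  [set f in homs A B adj | injectiveb f].

(** Convexity is used twice: over vertices, to bound the total codegree of the placements of [A],
    then over these placements, to count the extensions to [B]. The last hypothesis makes the
    non-injective maps at most half of the bound obtained. *)
Lemma card_inj_homs_ge (R : realFieldType) (A B T : finType) (adj : rel T) (c : R) :
  0 <= c -> (0 < #|T|)%N ->
  c * #|T|%:R ^+ 2 <= (\sum_v #|[pred u | adj u v]|)%:R ->
  (#|A| + #|B|)%:R ^+ 2 <= c ^+ (#|A| * #|B|) / 2 * #|T|%:R ->
  c ^+ (#|A| * #|B|) / 2 * #|T|%:R ^+ (#|A| + #|B|) <= #|inj_homs A B adj|%:R.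
Proof.
move=> c0 T0 hc hn.
set t : R := #|T|%:R in hc hn *; set a := #|A| in hn *; set b := #|B| in hn *.
have t0 : 0 < t by rewrite ltr0n.
set m := \sum_v _ in hc; set C := (\sum_v #|[pred u | adj u v]| ^ a)%N.
have hC : c ^+ a * t ^+ a.+1 <= C%:R.
  have := power_mean (fun v => #|[pred u | adj u v]|) a.
  rewrite -/m -/C -(ler_nat R) !natrM !natrX -/t => h.
  rewrite -(ler_pM2l (exprn_gt0 a t0)); apply: le_trans h.
  rewrite exprSr !mulrA; apply: ler_wpM2r; first exact: ltW.
  rewrite mulrAC -!exprMn [X in X ^+ _](_ : _ = c * t ^+ 2); last by ring.
  by rewrite lerXn2r ?nnegrE ?mulr_ge0 ?exprn_ge0 ?ler0n //.
have hH : c ^+ (a * b) * t ^+ (a + b) <= #|homs A B adj|%:R.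
  have := power_mean (fun x : {ffun A -> T} => #|[pred v | [forall a, adj (x a) v]]|) b.
  rewrite sum_codegree -/C card_ffun -/a => h.
  have {h} := leq_trans h (leq_mul (leqnn _) (card_homs_ge A B adj)).
  rewrite -(ler_nat R) !natrM !natrX -/t => h.
  have ta : 0 < (t ^+ a) ^+ b by rewrite !exprn_gt0.
  rewrite -(ler_pM2l ta); apply: le_trans h.
  apply: le_trans (_ : (c ^+ a * t ^+ a.+1) ^+ b * t ^+ a <= _).
    rewrite exprMn -!exprM.
    by rewrite le_eqVlt; apply/orP; left; apply/eqP; rewrite mulSn !exprD; ring.
  apply: ler_wpM2r; first by rewrite exprn_ge0 ?ltW.
  by rewrite lerXn2r ?nnegrE ?mulr_ge0 ?exprn_ge0 ?ler0n ?(ltW t0) //.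
have hsub : (#|homs A B adj| <= #|inj_homs A B adj| + #|[set f : {ffun A + B -> T} | ~~ injectiveb
  f]|)%N.
  rewrite (leq_trans _ (leq_card_setU _ _)) //; apply: subset_leq_card.
  by apply/subsetP=> f fH; rewrite !inE in fH *; rewrite fH; case: injectiveb.
have hN : #|[set f : {ffun A + B -> T} | ~~ injectiveb f]|%:R <= c ^+ (a * b) / 2 * t ^+ (a + b).
  have := card_noninj_le (A + B)%type T.
  rewrite -(ler_nat R) !natrM !natrX card_sum -/a -/b -/t => h.
  rewrite -(ler_pM2l t0); apply: le_trans h _.
  by rewrite mulrA [t * _]mulrC; apply: ler_wpM2r; rewrite ?exprn_ge0 // ltW.
by move: hsub; rewrite -(ler_nat R) natrD => hsub; lra.
Qed.

(** * Growing rainbow cliques *)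

Local Open Scope nat_scope.

Definition pairs (T : finType) (K : {set T}) : {set {set T}} :=
  [set e in powerset K | #|e| == 2].

Definition rainbow_set (n : nat) (H : {set {set 'I_n}}) (c : {set 'I_n} -> nat)
    (K : {set 'I_n}) : Prop :=
  {in K &, forall x y, x != y -> [set x; y] \in H} /\ {in pairs K &, injective c}.

Lemma pairsP (T : finType) (K e : {set T}) :
  reflect (exists x y, [/\ x \in K, y \in K, x != y & e = [set x; y]]) (e \in pairs K).
Proof.
rewrite !inE; apply: (iffP andP) => [[eK /cards2P[x [y [xy ee]]]]|[x [y [xK yK xy ->]]]].
  exists x, y; split=> //; rewrite (subsetP eK) // ee !inE eqxx ?orbT //.
by rewrite cards2 xy; split=> //; apply/subsetP=> z /set2P[] ->.
Qed.

Lemma pair_in_pairs (T : finType) (K : {set T}) (x y : T) :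
  x \in K -> y \in K -> x != y -> [set x; y] \in pairs K.
Proof. by move=> xK yK xy; apply/pairsP; exists x, y. Qed.

Lemma set2_inj (T : finType) (x y z : T) : [set x; y] = [set x; z] -> y = z.
Proof.
move=> e; have: y \in [set x; z] by rewrite -e !inE eqxx orbT.
have: z \in [set x; y] by rewrite e !inE eqxx orbT.
by rewrite !inE => /orP[/eqP->|/eqP-> //]; case/orP=> /eqP.
Qed.

Lemma set2I_neq0 (T : finType) (x : T) (e1 e2 : {set T}) :
  x \in e1 -> x \in e2 -> e1 :&: e2 != set0.
Proof. by move=> x1 x2; apply/set0Pn; exists x; rewrite inE x1. Qed.

Lemma pairs_setU1 (T : finType) (K e : {set T}) (u : T) :
  e \in pairs (u |: K) -> e \in pairs K \/ exists2 x, x \in K & e = [set x; u].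
Proof.
case/pairsP=> x [y [/setU1P[->|xK] /setU1P[->|yK] xy ->]].
- by rewrite eqxx in xy.
- by right; exists y => //; rewrite setUC.
- by right; exists x.
- by left; apply: pair_in_pairs.
Qed.

(** Properness already separates two edges at [u], and [xu] from the edges of [K] through [x]; only
    the edges of [K] avoiding [x] need a hypothesis. *)
Lemma rainbow_setU1 (n : nat) (H : {set {set 'I_n}}) (c : {set 'I_n} -> nat)
    (K : {set 'I_n}) (u : 'I_n) :
  proper_colouring H c -> rainbow_set H c K -> u \notin K ->
  (forall x, x \in K -> [set x; u] \in H) ->
  (forall x e, x \in K -> e \in pairs (K :\ x) -> c [set x; u] != c e) ->
  rainbow_set H c (u |: K).
Proof.
move=> pc [KH Kc] uK KuH noclash; split.
  move=> x y /setU1P[->|xK] /setU1P[->|yK]; rewrite ?eqxx // => xy.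
  - by rewrite setUC KuH.
  - by rewrite KuH.
  - exact: KH.
have new x e : x \in K -> e \in pairs K -> c [set x; u] != c e.
  move=> xK eK; have [xe|xe] := boolP (x \in e).
    case/pairsP: (eK) => a [b [aK bK ab eab]].
    apply: pc; rewrite ?KuH ?eab ?KH //; last first.
      by apply: (set2I_neq0 (x := x)); rewrite -?eab // !inE eqxx.
    apply: contraNneq uK => eq2.
    have : u \in [set a; b] by rewrite -eq2 !inE eqxx orbT.
    by case/set2P=> ->.
  apply: noclash => //; move: eK; rewrite !inE => /andP[eK ->]; rewrite andbT.
  by rewrite subsetD1 eK xe.
move=> e1 e2 /pairs_setU1[e1K|[x xK ->]] /pairs_setU1[e2K|[y yK ->]].
- exact: Kc.
- by move/esym/eqP; rewrite (negPf (new _ _ _ _)).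
- by move/eqP; rewrite (negPf (new _ _ _ _)).
- move=> /eqP exy; apply/eqP; apply: contraTT exy => xy.
  apply: pc; rewrite ?KuH //.
  by apply: (set2I_neq0 (x := u)); rewrite !inE eqxx orbT.
Qed.

(* An edge [{x, u}] can only clash with an edge of [K] avoiding [x], and each
   clash [(x, e)] rules out at most one [u]. *)
Lemma rainbow_extend (n : nat) (H : {set {set 'I_n}}) (c : {set 'I_n} -> nat)
    (K U : {set 'I_n}) :
  proper_colouring H c -> rainbow_set H c K -> [disjoint K & U] ->
  (forall x u, x \in K -> u \in U -> [set x; u] \in H) ->
  #|K| * 'C(#|K|.-1, 2) < #|U| ->
  exists2 u, u \in U & rainbow_set H c (u |: K).
Proof.
move=> pc rK dKU KUH.
pose clash (u : 'I_n) (xe : 'I_n * {set 'I_n}) :=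
  [&& xe.1 \in K, xe.2 \in pairs (K :\ xe.1) & c [set xe.1; u] == c xe.2].
have KU u : u \in U -> u \notin K by move=> uU; rewrite (disjointFl dKU uU).
have [/existsP[u /andP[uU /existsPn nclash]] _|/existsPn allclash] :=
  boolP [exists u, (u \in U) && ~~ [exists xe, clash u xe]].
  exists u => //; apply: rainbow_setU1 => //; first exact: KU.
    by move=> x xK; apply: KUH.
  by move=> x e xK eK; have := nclash (x, e); rewrite /clash /= xK eK.
rewrite ltnNge => /negP[].
have clashP u : u \in U -> exists xe, clash u xe.
  move=> uU; have := allclash u; rewrite uU /= negbK => /existsP[xe]; by exists xe.
have [->|/set0Pn[u0 u0U]] := eqVneq U set0; first by rewrite cards0.
have [xe0 _] := clashP _ u0U.
pose h u := odflt xe0 [pick xe | clash u xe].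
have hP u : u \in U -> clash u (h u).
  by rewrite /h => /clashP[xe cl]; case: pickP => [//|/(_ xe)]; rewrite cl.
have hinj : {in U &, injective h}.
  move=> u u' uU uU' huu; have /and3P[xK _ /eqP e1] := hP _ uU.
  have /and3P[_ _ /eqP e2] := hP _ uU'; rewrite -huu in e2.
  apply/eqP; apply: contraTT isT => uu.
  have := pc _ _ (KUH _ _ xK uU) (KUH _ _ xK uU').
  rewrite e1 -e2 eqxx; apply.
    by apply: contraNneq uu => /set2_inj ->.
  by apply: (set2I_neq0 (x := (h u).1)); rewrite !inE eqxx.
rewrite -(card_in_imset hinj).
apply: leq_trans (_ : #|[set xe : 'I_n * {set 'I_n} | (xe.1 \in K) && (xe.2 \in pairs (K :\
  xe.1))]| <= _).
  apply: subset_leq_card; apply/subsetP=> _ /imsetP[u uU ->].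
  by have /and3P[xK eK _] := hP _ uU; rewrite inE xK.
rewrite -sum1_card (eq_bigl (fun xe : 'I_n * {set 'I_n} => (xe.1 \in K) && (xe.2 \in pairs (K :\
  xe.1)))) => [|xe]; last by rewrite inE.
rewrite -(pair_big_dep (fun x : 'I_n => x \in K) (fun x e => e \in pairs (K :\ x)) (fun _ _ => 1))
  /=.
rewrite -sum_nat_const leq_sum // => x xK; rewrite sum1_card.
have -> : #|K|.-1 = #|K :\ x| by rewrite (cardsD1 x K) xK.
by rewrite -cards_draws; apply: eq_leq; apply: eq_card => e; rewrite !inE.
Qed.

Lemma rainbow_set0 (n : nat) (H : {set {set 'I_n}}) c : rainbow_set H c set0.
Proof. by split=> [x y|e1 e2]; [rewrite inE|case/pairsP=> x [y []]; rewrite inE]. Qed.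

Lemma rainbow_set_clique (n l : nat) (H : {set {set 'I_n}}) c (K : {set 'I_n}) :
  rainbow_set H c K -> #|K| = l -> has_rainbow_clique l H c.
Proof.
move=> [KH Kc] <-; exists (fun i : 'I_#|K| => enum_val i); split; first exact: enum_val_inj.
have neq (i j : 'I_#|K|) : i != j -> enum_val i != enum_val j.
  by apply: contraNneq => /enum_val_inj ->.
split=> [i j ij|i j i' j' ij ij' ne]; first by rewrite KH ?enum_valP ?neq.
apply: contraNneq ne => /Kc ->; rewrite ?pair_in_pairs ?enum_valP ?neq //.
Qed.

(** The three hypotheses concern the perfect matchings of K_4, the only pairs of edges to which a
    proper colouring may give one colour. *)
Lemma rainbow_K4 (n : nat) (H : {set {set 'I_n}}) c (x y z w : 'I_n) :
  proper_colouring H c -> uniq [:: x; y; z; w] ->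
  {in [:: x; y; z; w] &, forall a b, a != b -> [set a; b] \in H} ->
  c [set x; y] != c [set z; w] -> c [set x; z] != c [set y; w] ->
  c [set y; z] != c [set x; w] -> has_rainbow_clique 4 H c.
Proof.
move=> pc /and4P[] /=; rewrite !inE !negb_or => /and3P[xy xz xw] /andP[yz yw] zw _ KH c1 c2 c3.
(* With at most two vertices no pair avoids a given one, so the first three vertices are added
   without any clash to exclude. *)
have small (K : {set 'I_n}) a e : #|K| <= 2 -> a \in K -> e \notin pairs (K :\ a).
  move=> cK aK; rewrite !inE; apply/negP=> /andP[/subset_leq_card eK /eqP e2].
  by move: cK eK; rewrite (cardsD1 a) aK e2 => h1 h2; have := leq_trans h2 h1.
have r1 : rainbow_set H c (x |: set0).
  apply: rainbow_setU1 => //; rewrite ?inE //; first exact: rainbow_set0.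
    by move=> a; rewrite inE.
  by move=> a e; rewrite inE.
have r2 : rainbow_set H c (y |: (x |: set0)).
  apply: rainbow_setU1 => //; rewrite ?inE ?orbF 1?eq_sym //.
    by move=> a; rewrite !inE orbF => /eqP ->; apply: KH; rewrite ?inE ?eqxx ?orbT.
  by move=> a e aK; rewrite (negPf (small _ _ _ _ aK)) // setU0 cards1.
have r3 : rainbow_set H c (z |: (y |: (x |: set0))).
  apply: rainbow_setU1 => //; rewrite ?inE ?orbF ?negb_or 1?eq_sym ?yz 1?eq_sym ?xz //.
    by move=> a; rewrite !inE orbF => /orP[]/eqP ->; apply: KH; rewrite ?inE ?eqxx ?orbT.
  by move=> a e aK; rewrite (negPf (small _ _ _ _ aK)) // setU0 cards2 1?eq_sym xy.
have r4 : rainbow_set H c (w |: (z |: (y |: (x |: set0)))).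
  apply: rainbow_setU1 => //.
  - by rewrite !inE orbF !negb_or ![w == _]eq_sym zw yw xw.
  - by move=> a; rewrite !inE orbF => /or3P[]/eqP ->; apply: KH; rewrite ?inE ?eqxx ?orbT.
  move=> a e; rewrite setU0 !inE => aK /andP[eK /eqP e2].
  have ab b1 b2 : b1 != b2 -> (forall v, v \in z |: [set y; x] -> v != a -> v \in [set b1;
    b2]) -> e = [set b1; b2].
    move=> b12 hb; apply/eqP; rewrite eqEcard e2 cards2 b12 andbT.
    by apply/subsetP=> v /(subsetP eK); rewrite inE in_set1 => /andP[va vK]; apply: hb.
  case/or3P: aK ab => /eqP -> ab.
  - rewrite (ab x y xy) 1?eq_sym // => v; rewrite !inE => /or3P[]/eqP -> //; rewrite ?eqxx ?orbT //.
  - rewrite (ab x z xz) 1?eq_sym // => v; rewrite !inE => /or3P[]/eqP -> //; rewrite ?eqxx ?orbT //.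
  - rewrite (ab y z yz) 1?eq_sym // => v; rewrite !inE => /or3P[]/eqP -> //; rewrite ?eqxx ?orbT //.
apply: (rainbow_set_clique r4).
by rewrite setU0 !cardsU1 cards1 !inE !negb_or (eq_sym y x) ![z == _]eq_sym ![w == _]eq_sym xy xz
  yz xw yw zw.
Qed.

Lemma rainbow_extend_image (n : nat) (V I : finType) (H : {set {set 'I_n}}) c
    (f : V -> 'I_n) (S : {set V}) (v : I -> V) k :
  proper_colouring H c -> injective f -> injective v ->
  rainbow_set H c (f @: S) -> #|S| = k -> (forall i, v i \notin S) ->
  (forall x i, x \in S -> [set f x; f (v i)] \in H) ->
  k * 'C(k.-1, 2) < #|I| ->
  exists i, rainbow_set H c (f @: (v i |: S)) /\ #|v i |: S| = k.+1.
Proof.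
move=> pc injf injv rS cS vS SH kI.
have injfv : injective (f \o v) by apply: inj_comp.
have [|x u|| u /imsetP[i _ ->] ri] := rainbow_extend (U := (f \o v) @: setT) pc rS.
- rewrite disjoint_sym; apply/pred0P=> x /=; apply/negP=> /andP[/imsetP[i _ ->] /imsetP[y yS]].
  by move/injf=> yv; have := vS i; rewrite yv yS.
- by case/imsetP=> y yS -> /imsetP[i _ ->]; apply: SH.
- by rewrite !card_imset ?cS // cardsT.
by exists i; rewrite cardsU1 vS cS imsetU1.
Qed.

(** * The graphs forcing rainbow cliques and their densities *)

(** The relation lists an edge in one direction only, cyclically in a triangle and otherwise back to
    an earlier vertex. The edges inside a set are then bounded by the sum of small out-degrees. *)
Definition rel_edges (V : finType) (e : rel V) : {set {set V}} :=
  [set [set xy.1; xy.2] | xy : V * V in [pred xy | e xy.1 xy.2]].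

Lemma card_edges_in_rel (V : finType) (e : rel V) (J : {set V}) :
  #|edges_in (rel_edges e) J| <= \sum_(x in J) #|[pred y in J | e x y]|.
Proof.
under eq_bigr => x _ do rewrite -sum1_card.
rewrite pair_big_dep /= sum1_card.
apply: leq_trans (leq_imset_card (fun xy : V * V => [set xy.1; xy.2]) _).
apply: subset_leq_card; apply/subsetP=> _ /setIdP[/imsetP[[x y] /= exy ->] sJ].
apply/imsetP; exists (x, y) => //; rewrite unfold_in /= inE.
by rewrite !(subsetP sJ) ?inE ?eqxx ?orbT.
Qed.

Lemma copy_rel_edges (V T : finType) (e : rel V) (f : {ffun V -> T}) x y :
  e x y -> [set f x; f y] \in copy (rel_edges e) f.
Proof.
move=> exy; apply/imsetP; exists [set x; y]; last by rewrite imsetU1 imset_set1.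
by apply/imsetP; exists (x, y).
Qed.

Lemma copy_rel_edges_sub (V : finType) n (e : rel V) (f : {ffun V -> 'I_n}) :
  irreflexive e -> injective f -> copy (rel_edges e) f \subset all_edges n.
Proof.
move=> eirr injf; apply/subsetP=> _ /imsetP[_ /imsetP[[x y] /= exy ->] ->].
rewrite inE imsetU1 imset_set1 cards2 (inj_eq injf).
by rewrite (_ : x != y) //; apply: contraTneq exy => ->; rewrite inE /= eirr.
Qed.

Definition edge_map (V : finType) n (H : {set {set 'I_n}}) (e : rel V) (f : V -> 'I_n) :=
  forall x y, e x y -> [set f x; f y] \in H.

Lemma edge_mapC (V : finType) n (H : {set {set 'I_n}}) (e : rel V) (f : V -> 'I_n) x y :
  edge_map H e f -> e x y || e y x -> [set f x; f y] \in H.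
Proof. by move=> ef /orP[/ef //|/ef]; rewrite setUC. Qed.

(** The edges [e] inside the two classes will come from the random graph, all edges between the
    classes from the dense graph. *)
Definition cross (A B : finType) (e : rel (A + B)%type) : rel (A + B)%type :=
  fun x y => e x y || match x, y with inl _, inr _ => true | _, _ => false end.

Definition stars_rel (x y : 'I_5 + 'I_5) : bool :=
  match x, y with
  | inl i, inl j | inr i, inr j => (i != ord0) && (j == ord0)
  | _, _ => false
  end.

(** A rainbow triangle in the first class is extended by some [i], then by some [(i, j)] adjacent to
    it; the [t] candidates at each stage leave room for the excluded ones. *)
Definition tree_rel t (x y : 'I_3 + ('I_t + 'I_t * 'I_t)) : bool :=
  match x, y with
  | inl i, inl j => j == ordS i
  | inr (inr v), inr (inl i) => v.1 == i
  | _, _ => false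
  end.

(** In the second class [i], [(i, j)] and [(i, j, k)] span a triangle: they are the last three
    vertices of K_7, chosen one after the other. *)
Definition two_tree_rel t
    (x y : ('I_3 + 'I_4) + ('I_t + ('I_t * 'I_t + 'I_t * 'I_t * 'I_t))) : bool :=
  match x, y with
  | inl (inl i), inl (inl j) => j == ordS i
  | inl (inr _), inl (inl _) => true
  | inr (inr (inl v)), inr (inl i) => v.1 == i
  | inr (inr (inr v)), inr (inl i) => v.1.1 == i
  | inr (inr (inr v)), inr (inr (inl w)) => v.1 == w
  | _, _ => false
  end.

Lemma ordS3_neq (i j : 'I_3) : i != j -> (j == ordS i) || (i == ordS j).
Proof. by case: i => [[|[|[|]]] // ?]; case: j => [[|[|[|]]] // ?]. Qed.

Lemma rainbow_triple n (V : finType) (H : {set {set 'I_n}}) c (f : V -> 'I_n) (v : 'I_3 -> V) :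
  proper_colouring H c -> injective f -> injective v ->
  (forall i j, i != j -> [set f (v i); f (v j)] \in H) ->
  rainbow_set H c (f @: (v @: setT)).
Proof.
move=> pc injf injv vH.
have ev i : v i \in v @: setT by apply: imset_f.
split=> [_ _ /imsetP[_ /imsetP[i _ ->] ->] /imsetP[_ /imsetP[j _ ->] ->] ij|].
  by apply: vH; apply: contraNneq ij => ->.
have inH e : e \in pairs (f @: (v @: setT)) -> exists i j, [/\ i != j, e = [set f (v i);
  f (v j)] & e \in H].
  case/pairsP=> _ [_ [/imsetP[_ /imsetP[i _ ->] ->] /imsetP[_ /imsetP[j _ ->] ->] ij ->]].
  have ne : i != j by apply: contraNneq ij => ->.
  by exists i, j; split=> //; apply: vH.
move=> e1 e2 /inH[i [j [ij ee1 h1]]] /inH[i' [j' [ij' ee2 h2]]] cc.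
apply/eqP; apply: contra_eqT cc => ne; apply: pc => //.
have [x x1 x2] : exists2 x, x \in [set i; j] & x \in [set i'; j'].
  apply/exists_inP; move: ij ij'.
  case: i {ee1} => [[|[|[|]]] // ?]; case: j => [[|[|[|]]] // ?];
  case: i' {ee2} => [[|[|[|]]] // ?]; case: j' => [[|[|[|]]] // ?] // _ _;
  apply/exists_inP;
  first [by exists (@Ordinal 3 0 isT); rewrite !inE
       | by exists (@Ordinal 3 1 isT); rewrite !inE
       | by exists (@Ordinal 3 2 isT); rewrite !inE].
apply: (set2I_neq0 (x := f (v x))).
  by rewrite ee1; case/set2P: x1 => ->; rewrite !inE eqxx ?orbT.
by rewrite ee2; case/set2P: x2 => ->; rewrite !inE eqxx ?orbT.
Qed.

(* [12 = 4 * 'C(3, 2)] and, below, [60 = 6 * 'C(5, 2)] are what the last extension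
   step requires of the branching number [t]. *)
Lemma rbw_arrow_tree t n (H : {set {set 'I_n}}) (f : 'I_3 + ('I_t + 'I_t * 'I_t) -> 'I_n) :
  12 < t -> injective f -> edge_map H (cross (@tree_rel t)) f -> rbw_arrow 5 H.
Proof.
move=> tbig injf fH c pc.
have inl_inj' : injective (fun i : 'I_3 => inl i : 'I_3 + ('I_t + 'I_t * 'I_t)) by move=> ? ? [].
have r3 : rainbow_set H c (f @: (inl @: setT)).
  by apply: rainbow_triple => // i j ij; apply: (edge_mapC fH); rewrite /cross /= !orbF ordS3_neq.
have c3 : #|(fun i : 'I_3 => inl i : 'I_3 + ('I_t + 'I_t * 'I_t)) @: setT| = 3 by rewrite
  card_imset // cardsT card_ord.
have [|i|w i /imsetP[j _ ->]||i [r4 c4]] :=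
  rainbow_extend_image (v := fun i : 'I_t => inr (inl i)) pc injf _ r3 c3.
- by move=> ? ? [].
- by apply/imsetP => -[].
- exact: fH.
- by rewrite card_ord (leq_trans _ tbig).
have [|j|x j||j [r5 c5]] :=
  rainbow_extend_image (v := fun j : 'I_t => inr (inr (i, j))) pc injf _ r4 c4.
- by move=> ? ? [].
- by rewrite !inE /=; apply/imsetP => -[].
- move=> /setU1P[->|/imsetP[k _ ->]]; last exact: fH.
  by apply: (edge_mapC fH); rewrite /cross /= eqxx.
- by rewrite card_ord.
by apply: (rainbow_set_clique r5); rewrite card_imset.
Qed.

Lemma rbw_arrow_two_tree t n (H : {set {set 'I_n}})
    (f : ('I_3 + 'I_4) + ('I_t + ('I_t * 'I_t + 'I_t * 'I_t * 'I_t)) -> 'I_n) :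
  60 < t -> injective f -> edge_map H (cross (@two_tree_rel t)) f -> rbw_arrow 7 H.
Proof.
move=> tbig injf fH c pc.
pose V := (('I_3 + 'I_4) + ('I_t + ('I_t * 'I_t + 'I_t * 'I_t * 'I_t)))%type.
have inj3 : injective (fun i : 'I_3 => inl (inl i) : V) by move=> ? ? [].
have r3 : rainbow_set H c (f @: ((fun i : 'I_3 => inl (inl i) : V) @: setT)).
  by apply: rainbow_triple => // i j ij; apply: (edge_mapC fH); rewrite /cross /= !orbF ordS3_neq.
have c3 : #|(fun i : 'I_3 => inl (inl i) : V) @: setT| = 3 by rewrite card_imset // cardsT card_ord.
(* Here [3 * 'C(2, 2) = 3 < 4]: each edge of the triangle excludes at most one of the four
   independent vertices. *)
have [|q|w q /imsetP[j _ ->]||q [r4 c4]] :=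
  rainbow_extend_image (v := fun i : 'I_4 => inl (inr i) : V) pc injf _ r3 c3.
- by move=> ? ? [].
- by apply/imsetP => -[].
- exact: (edge_mapC fH).
- by rewrite card_ord.
have [|i|x i||i [r5 c5]] :=
  rainbow_extend_image (v := fun i : 'I_t => inr (inl i) : V) pc injf _ r4 c4.
- by move=> ? ? [].
- by rewrite !inE /=; apply/imsetP => -[].
- by case/setU1P=> [->|/imsetP[k _ ->]]; apply: fH.
- by rewrite card_ord (leq_trans _ tbig).
have [|j|x j||j [r6 c6]] :=
  rainbow_extend_image (v := fun j : 'I_t => inr (inr (inl (i, j))) : V) pc injf _ r5 c5.
- by move=> ? ? [].
- by rewrite !inE /=; apply/imsetP => -[].
- move=> /setU1P[->|/setU1P[->|/imsetP[k _ ->]]]; try exact: fH.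
  by apply: (edge_mapC fH); rewrite /cross /= eqxx.
- by rewrite card_ord (leq_trans _ tbig).
have [|k|x k||k [r7 c7]] :=
  rainbow_extend_image (v := fun k : 'I_t => inr (inr (inr (i, j, k))) : V) pc injf _ r6 c6.
- by move=> ? ? [].
- by rewrite !inE /=; apply/imsetP => -[].
- move=> /setU1P[->|/setU1P[->|/setU1P[->|/imsetP[l _ ->]]]]; try exact: fH.
    by apply: (edge_mapC fH); rewrite /cross /= eqxx.
  by apply: (edge_mapC fH); rewrite /cross /= eqxx.
- by rewrite card_ord.
by apply: (rainbow_set_clique r7); rewrite card_imset.
Qed.

Lemma rbw_arrow_stars n (H : {set {set 'I_n}}) (f : 'I_5 + 'I_5 -> 'I_n) :
  injective f -> edge_map H (cross stars_rel) f -> rbw_arrow 4 H.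
Proof.
move=> injf fH c pc.
pose a (i : 'I_4) := f (inl (lift ord0 i)); pose a0 := f (inl ord0).
pose b (i : 'I_4) := f (inr (lift ord0 i)); pose b0 := f (inr ord0).
(* One set per perfect matching of [a0], [a i], [b0], [b j]. For fixed [i] one edge of the matching
   is fixed and the other turns around a fixed vertex as [j] varies, so at most one [j] is bad and
   each set has at most four elements. *)
pose Q1 := [set ij : 'I_4 * 'I_4 | c [set a0; a ij.1] == c [set b0; b ij.2]].
pose Q2 := [set ij : 'I_4 * 'I_4 | c [set a0; b0] == c [set a ij.1; b ij.2]].
pose Q3 := [set ij : 'I_4 * 'I_4 | c [set a ij.1; b0] == c [set a0; b ij.2]].
have binj : injective b.
  move=> i j /injf e; apply: (@lift_inj _ ord0).
  exact: (congr1 (fun s : 'I_5 + 'I_5 => if s is inr k then k else ord0) e).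
have a0H i : [set a0; a i] \in H by apply: (edge_mapC fH); rewrite /cross /=.
have b0H i : [set b0; b i] \in H by apply: (edge_mapC fH); rewrite /cross /=.
have abH x y : [set f (inl x); f (inr y)] \in H by apply: (edge_mapC fH).
have cardQ (g : 'I_4 -> 'I_4 -> {set 'I_n}) (h : 'I_4 -> {set 'I_n}) v :
    (forall i j, [/\ g i j \in H, v i \in g i j & forall j', g i j = g i j' -> j = j']) ->
    #|[set ij : 'I_4 * 'I_4 | c (h ij.1) == c (g ij.1 ij.2)]| <= 4.
  move=> gP; rewrite -[leqRHS]card_ord -(@card_in_imset _ _ fst) ?max_card //.
  move=> [i j] [i' j']; rewrite !inE /= => /eqP e1 /eqP e2 ii; subst i'; congr (_, _).
  have [gH vg ginj] := gP i j; have [gH' vg' _] := gP i j'.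
  apply/eqP; have : c (g i j) == c (g i j') by rewrite -e1 -e2.
  apply: contraTT => jj; apply: pc => //; last exact: (set2I_neq0 (x := v i)).
  by apply: contraNneq jj => /ginj ->.
have c1 : #|Q1| <= 4.
  apply: (cardQ (fun _ j => [set b0; b j]) (fun i => [set a0; a i]) (fun=> b0)) => i j.
  by split=> [//||j' /set2_inj/binj //]; rewrite !inE eqxx.
have c2 : #|Q2| <= 4.
  apply: (cardQ (fun i j => [set a i; b j]) (fun i => [set a0; b0]) a) => i j.
  by split=> [||j' /set2_inj/binj //]; rewrite ?abH // !inE eqxx.
have c3 : #|Q3| <= 4.
  apply: (cardQ (fun i j => [set a0; b j]) (fun i => [set a i; b0]) (fun=> a0)) => i j.
  by split=> [||j' /set2_inj/binj //]; rewrite ?abH // !inE eqxx.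
have /existsP[[i j] nQ] : [exists ij, ij \notin Q1 :|: Q2 :|: Q3].
  rewrite -negb_forall; apply/negP=> /forallP allQ.
  have: #|[set: 'I_4 * 'I_4]| <= #|Q1 :|: Q2 :|: Q3|.
    by apply: subset_leq_card; apply/subsetP=> ij _; apply: allQ.
  rewrite cardsT card_prod !card_ord leqNgt => /negP; apply.
  rewrite (leq_ltn_trans (leq_card_setU _ _)) // (leq_ltn_trans (leq_add (leq_card_setU _ _)
    (leqnn _))) //.
  by rewrite (leq_ltn_trans (leq_add (leq_add c1 c2) c3)).
move: nQ; rewrite !inE !negb_or /= => /andP[/andP[n1 n2] n3].
apply: (rainbow_K4 (x := a0) (y := a i) (z := b0) (w := b j)) => //.
  by rewrite /= !inE !negb_or !(inj_eq injf).
have sym x y : [set x; y] \in H -> [set y; x] \in H by rewrite setUC.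
by move=> x y; rewrite !inE => /or4P[]/eqP-> /or4P[]/eqP->; rewrite ?eqxx // => _;
  rewrite ?abH // sym ?abH.
Qed.

Lemma card_edges_in_double_sum (V : finType) (e : rel V) (J : {set V}) :
  #|edges_in (rel_edges e) J| <= \sum_x \sum_y [&& x \in J, y \in J & e x y].
Proof.
apply: leq_trans (card_edges_in_rel e J) _.
rewrite big_mkcond leq_sum // => x _; case: ifP => // xJ.
by rewrite -sum1_card big_mkcond leq_sum // => y _; rewrite inE; case: ifP.
Qed.

Lemma sum_at_most_one (V : finType) (P : pred V) (y0 : V) :
  (forall y, P y -> y = y0) -> \sum_y P y <= 1.
Proof.
move=> h; rewrite (bigD1 y0) //= big1 ?addn0 ?leq_b1 // => y yy.
by apply/eqP; rewrite eqb0; apply: contraNN yy => /h ->.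
Qed.

Lemma card_sum_mem (V : finType) (J : {set V}) : #|J| = \sum_x (x \in J).
Proof. by rewrite -sum1_card big_mkcond; apply: eq_bigr => x _; case: ifP. Qed.

Lemma tree_rel_irr t : irreflexive (@tree_rel t).
Proof. by case=> [i|[i|[i j]]] //=; apply/eqP => /(congr1 val) /=; case: i => [[|[|[|]]]]. Qed.

Lemma two_tree_rel_irr t : irreflexive (@two_tree_rel t).
Proof. by case=> [[i|i]|[i|[[i j]|[[i j] k]]]] //=; apply/eqP => /(congr1 val) /=;
  case: i => [[|[|[|]]]]. Qed.

Lemma stars_rel_irr : irreflexive stars_rel.
Proof. by case=> i /=; case: eqP. Qed.

(** A centre with [m <= 4] leaves satisfies [5 * m <= 4 * m.+1], with equality for the whole
    star. *)
Lemma stars_sparse (J : {set 'I_5 + 'I_5}) : 5 * #|edges_in (rel_edges stars_rel) J| <= 4 * #|J|.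
Proof.
apply: leq_trans (leq_mul (leqnn _) (card_edges_in_double_sum _ J)) _.
rewrite card_sum_mem !big_sumType /= mulnDr [leqRHS]mulnDr.
have star (b : pred 'I_5) :
    5 * \sum_i \sum_j [&& b i, b j, i != ord0 & j == ord0] <= 4 * \sum_i b i.
  rewrite (_ : \sum_i \sum_j _ = \sum_i [&& b i, i != ord0 & b ord0]); last first.
    apply: eq_bigr => i _; rewrite (bigD1 ord0) //= big1 ?addn0.
      by case: (b i); case: (b ord0); case: (i == ord0).
    by move=> j /negPf ->; rewrite !andbF.
  rewrite !big_ord_recl !big_ord0 /=.
  by case: (b ord0); case: (b (lift _ _)); case: (b (lift _ _)); case: (b (lift _ _));
    case: (b (lift _ _)).
apply: leq_add.
  apply: leq_trans (star (fun i => inl i \in J)).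
  rewrite leq_mul // leq_sum // => i _; rewrite big_sumType /= [X in _ + X]big1 ?addn0 //.
  by move=> j _; rewrite !andbF.
apply: leq_trans (star (fun i => inr i \in J)).
rewrite leq_mul // leq_sum // => i _; rewrite big_sumType /= big1 ?add0n //.
by move=> j _; rewrite !andbF.
Qed.

Lemma tree_sparse t (J : {set 'I_3 + ('I_t + 'I_t * 'I_t)}) :
  1 * #|edges_in (rel_edges (@tree_rel t)) J| <= 1 * #|J|.
Proof.
rewrite !mul1n; apply: leq_trans (card_edges_in_double_sum _ J) _.
rewrite card_sum_mem; apply: leq_sum => x _.
have [xJ|xJ] := boolP (x \in J); last by rewrite big1.
case: x xJ => [i|[i|v]] _.
- by apply: (@sum_at_most_one _ _ (inl (ordS i))) => -[j|[j|w]] /and3P[_ _] //= /eqP ->.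
- by rewrite big1 // => -[j|[j|w]] _; rewrite andbF.
- by apply: (@sum_at_most_one _ _ (inr (inl v.1))) => -[j|[j|w]] /and3P[_ _] //= /eqP ->.
Qed.

(** In the second class out-degrees are at most 2, and [7 * 2 <= 15]. In the first, the critical
    case is the whole triangle with [m] independent vertices: [7 * (3 + 3 * m) <= 15 * (3 + m)]
    amounts to [m <= 4]. *)
Lemma two_tree_sparse t (J : {set ('I_3 + 'I_4) + ('I_t + ('I_t * 'I_t + 'I_t * 'I_t * 'I_t))}) :
  7 * #|edges_in (rel_edges (@two_tree_rel t)) J| <= 15 * #|J|.
Proof.
apply: leq_trans (leq_mul (leqnn _) (card_edges_in_double_sum _ J)) _.
rewrite card_sum_mem [in leqLHS]big_sumType [in leqRHS]big_sumType /= mulnDr [leqRHS]mulnDr.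
apply: leq_add; last first.
  rewrite !big_distrr /= leq_sum // => x _; case: (boolP (inr x \in J)) => xJ; last by rewrite big1.
  rewrite muln1 (@leq_trans (7 * 2)) // leq_mul //.
  case: x xJ => [i|[v|v]] _.
  - by rewrite big1 // => -[[j|j]|[j|[w|w]]] _; rewrite ?andbF.
  - apply: (@leq_trans 1) => //; apply: (@sum_at_most_one _ _ (inr (inl v.1))).
    by move=> [[j|j]|[j|[w|w]]] /and3P[_ _] //= /eqP ->.
  - rewrite !big_sumType /= big1 => [|j _]; last by rewrite andbF.
    rewrite add0n big1 => [|j _]; last by rewrite andbF.
    rewrite add0n [X in _ + (_ + X)]big1 => [|j _]; last by rewrite andbF.
    rewrite addn0 (@leq_add _ _ 1 1) //.
      by apply: (@sum_at_most_one _ _ v.1.1) => j /andP[_ /eqP].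
    by apply: (@sum_at_most_one _ _ v.1) => j /andP[_ /eqP].
pose b (i : 'I_3) := inl (inl i) \in J; pose a := \sum_i b i.
set m := \sum_(q : 'I_4) (inl (inr q) \in J).
have m4 : m <= 4.
  by apply: leq_trans (leq_sum _ (fun i _ => leq_b1 _)) _; rewrite sum_nat_const card_ord.
rewrite [in leqLHS]big_sumType [in leqRHS]big_sumType /= -/m -/a.
have h1 : \sum_(i : 'I_3) \sum_y [&& inl (inl i) \in J, y \in J & two_tree_rel (inl (inl i)) y]
    <= \sum_i (b i && b (ordS i)).
  apply: leq_sum => i _; rewrite (bigD1 (inl (inl (ordS i)))) //= eqxx andbT -/(b i) -/(b (ordS i)).
  rewrite big1 ?addn0 // => -[[j|j]|y]; rewrite ?andbF //= => ne.
  by case: eqP => [e|]; rewrite ?andbF //; rewrite e eqxx in ne.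
have h2 : \sum_(q : 'I_4) \sum_y [&& inl (inr q) \in J, y \in J & two_tree_rel (inl (inr q)) y] <=
  m * a.
  rewrite /m big_distrl /= leq_sum // => q _; rewrite !big_sumType /=.
  have zs (I : finType) (u : bool) (h : pred I) : \sum_i [&& u, h i & false] = 0.
    by rewrite big1 // => i _; rewrite !andbF.
  rewrite !zs !addn0 /a big_distrr /= leq_sum // => i _.
  by rewrite andbT -/(b i) mulnb.
apply: leq_trans (leq_mul (leqnn 7) (leq_add h1 h2)) _.
rewrite /a !big_ord_recl !big_ord0 /=.
have -> : lift ord0 ord0 = ordS ord0 :> 'I_3 by apply/val_inj.
have -> : lift ord0 (lift ord0 ord0) = ordS (ordS ord0) :> 'I_3 by apply/val_inj.
have -> : ordS (ordS (ordS ord0)) = ord0 :> 'I_3 by apply/val_inj.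
by case: (b ord0); case: (b (ordS ord0)); case: (b (ordS (ordS ord0))); move: m4; rewrite /=;
  clear; lia.
Qed.

(** * Colouring clusters of K4s *)

Definition nbrs (T : finType) (E : {set {set T}}) (v : T) (S : {set T}) : {set T} :=
  [set x in S | [set v; x] \in E].

Definition clique4 (T : finType) (E : {set {set T}}) (Q : {set T}) : bool :=
  (#|Q| == 4) && (pairs Q \subset E).

Definition nonrainbow (T : finType) (c : {set T} -> nat) (Q : {set T}) : Prop :=
  exists e1 e2, [/\ e1 \in pairs Q, e2 \in pairs Q, e1 != e2 & c e1 = c e2].

(* [M] lists every colour used at least twice inside [S]. *)
Definition good_col (n : nat) (E : {set {set 'I_n}}) (S : {set 'I_n})
    (c : {set 'I_n} -> nat) (M : seq nat) : Prop :=
  [/\ proper_colouring (edges_in E S) c,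
      forall Q : {set 'I_n}, clique4 E Q -> Q \subset S -> nonrainbow c Q &
      {in edges_in E S &, forall e1 e2, e1 != e2 -> c e1 = c e2 -> c e1 \in M}].

Lemma clique4_adj (T : finType) (E : {set {set T}}) (Q : {set T}) x y :
  clique4 E Q -> x \in Q -> y \in Q -> x != y -> [set x; y] \in E.
Proof. by case/andP=> _ /subsetP QE xQ yQ xy; apply/QE/pair_in_pairs. Qed.

Lemma clique4_nbrs (T : finType) (E : {set {set T}}) (Q S : {set T}) v :
  clique4 E Q -> v \in Q -> Q \subset v |: S -> Q :\ v \subset nbrs E v S.
Proof.
move=> QK vQ QS; apply/subsetP=> x; rewrite !inE => /andP[xv xQ].
rewrite (clique4_adj QK) 1?eq_sym // andbT.
by have := subsetP QS x xQ; rewrite !inE (negPf xv).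
Qed.

Lemma card_edges_in_setU1 n (E : {set {set 'I_n}}) (S : {set 'I_n}) v :
  is_graph E -> v \notin S -> #|edges_in E (v |: S)| = #|edges_in E S| + #|nbrs E v S|.
Proof.
move=> EG vS.
have inj : {in nbrs E v S &, injective (fun x => [set v; x])} by move=> x y _ _ /set2_inj.
rewrite -(card_in_imset inj) -cardsUI [X in _ + X](_ : _ = 0) ?addn0; last first.
  apply/eqP; rewrite cards_eq0; apply/eqP/setP=> e; rewrite !inE.
  apply/negP=> /andP[/andP[_ eS] /imsetP[x _ ee]].
  by move/subsetP/(_ v): eS; rewrite ee !inE eqxx (negPf vS) => /(_ isT).
apply: eq_card => e; rewrite !inE; apply/andP/orP.
  move=> [eE eS]; have [ve|ve] := boolP (v \in e).
    right; have := subsetP EG e eE; rewrite inE => /cards2P[x [y [xy ee]]].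
    suff [z zv ez] : exists2 z, z != v & e = [set v; z].
      apply/imsetP; exists z => //; rewrite inE -ez eE andbT.
      by have := subsetP eS z; rewrite ez !inE (negPf zv) eqxx orbT => /(_ isT).
    move: ve; rewrite ee => /set2P[->|->]; first by exists y; rewrite // eq_sym.
    by exists x; rewrite // setUC.
  left; rewrite eE; apply/subsetP=> x xe; have := subsetP eS x xe.
  by rewrite !inE; case: eqP => // xv; rewrite -xv xe in ve.
case=> [/andP[eE eS]|/imsetP[x]]; first by rewrite eE (subset_trans eS) ?subsetUr.
rewrite inE => /andP[xS vxE] ->; rewrite vxE; split=> //.
by apply/subsetP=> y /set2P[->|->]; rewrite !inE ?eqxx ?xS ?orbT.
Qed.

Lemma good_col_sub n (E : {set {set 'I_n}}) (S : {set 'I_n}) c (M M' : seq nat) :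
  good_col E S c M -> {subset M <= M'} -> good_col E S c M'.
Proof. by move=> [pc nr hM] MM; split=> // e1 e2 h1 h2 ne ce; apply/MM/(hM e1 e2). Qed.

(** The default colour of a new edge: it exceeds every value of [c] and determines the edge, so only
    deliberate repetitions can clash. *)
Definition fresh (T : finType) (c : {set T} -> nat) (e : {set T}) : nat :=
  (\max_e' c e').+1 + enum_rank e.

Lemma fresh_neq (T : finType) (c : {set T} -> nat) (e e' : {set T}) : fresh c e <> c e'.
Proof. by move=> h; have := leq_bigmax (F := c) e'; rewrite -h /fresh; lia. Qed.

Lemma fresh_inj (T : finType) (c : {set T} -> nat) : injective (fresh c).
Proof. by move=> e e' /addnI /ord_inj /enum_rank_inj. Qed.

Lemma edges_in_setU1_notin n (E : {set {set 'I_n}}) (S : {set 'I_n}) v e :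
  e \in edges_in E (v |: S) -> v \notin e -> e \in edges_in E S.
Proof.
rewrite !inE => /andP[-> eS] ve; apply/subsetP=> x xe.
by have := subsetP eS x xe; rewrite !inE; case: eqP => // xv; rewrite -xv xe in ve.
Qed.

Lemma good_col_isolated n (E : {set {set 'I_n}}) (S : {set 'I_n}) c M v :
  v \notin S -> good_col E S c M ->
  (forall Q, clique4 E Q -> Q \subset v |: S -> v \notin Q) ->
  good_col E (v |: S) (fun e => if v \in e then fresh c e else c e) M.
Proof.
move=> vS [pc nr hM] nQ; split.
- move=> e1 e2 h1 h2 ne I12.
  case: ifP => [v1|/negbT v1]; case: ifP => [v2|/negbT v2].
  + by apply: contraNneq ne => /fresh_inj ->.
  + by apply/eqP/fresh_neq.
  + by apply/eqP/nesym/fresh_neq.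
  + by apply: pc => //; apply: edges_in_setU1_notin; eassumption.
- move=> Q QK QS; have vQ := nQ Q QK QS.
  have QS' : Q \subset S.
    apply/subsetP=> x xQ; have := subsetP QS x xQ; rewrite !inE.
    by case: eqP => // xv; rewrite -xv xQ in vQ.
  have [e1 [e2 [h1 h2 ne ce]]] := nr Q QK QS'.
  have nv e : e \in pairs Q -> (v \in e) = false.
    by rewrite !inE => /andP[eQ _]; apply: contraNF vQ => /(subsetP eQ).
  by exists e1, e2; rewrite !nv.
- move=> e1 e2 h1 h2 ne.
  case: ifP => [v1|/negbT v1]; case: ifP => [v2|/negbT v2].
  + by move/fresh_inj=> e12; rewrite e12 eqxx in ne.
  + by move/fresh_neq.
  + by move/esym/fresh_neq.
  + by apply: hM => //; apply: edges_in_setU1_notin; eassumption.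
Qed.

Definition col_step n (c : {set 'I_n} -> nat) (v a : 'I_n) (k : nat) (e : {set 'I_n}) : nat :=
  if v \in e then (if e == [set v; a] then k else fresh c e) else c e.

(* The new edge [va] receives the colour of the opposite edge [bd]. *)
Lemma good_col_step n (E : {set {set 'I_n}}) (S : {set 'I_n}) c M v a b d :
  is_graph E -> v \notin S -> good_col E S c M ->
  a != b -> a != d -> b != d ->
  nbrs E v S = [set a; b; d] -> [set b; d] \in E ->
  (forall x, x \in S -> [set a; x] \in E -> c [set a; x] != c [set b; d]) ->
  good_col E (v |: S) (col_step c v a (c [set b; d])) (c [set b; d] :: M).
Proof.
move=> EG vS [pc nr hM] ab ad bd Nv bdE free.
have [aS bS dS] : [/\ a \in S, b \in S & d \in S].
  have inN x : x \in [set a; b; d] -> x \in S by rewrite -Nv inE => /andP[].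
  by split; apply: inN; rewrite !inE eqxx ?orbT.
have meet e : e \in edges_in E S -> a \in e -> c e != c [set b; d].
  move=> eS ae; move: (eS); rewrite inE => /andP[eE eSS].
  have := subsetP EG e eE; rewrite inE => /cards2P[x [y [xy ee]]].
  have [z zS ez] : exists2 z, z \in S & e = [set a; z].
    move: ae eSS; rewrite ee => /set2P[->|->] sub.
      by exists y => //; apply: (subsetP sub); rewrite !inE eqxx orbT.
    by exists x; [apply: (subsetP sub); rewrite !inE eqxx|rewrite setUC].
  by rewrite ez free // -ez.
split.
- move=> e1 e2 h1 h2 ne I12; rewrite /col_step.
  wlog v1 : e1 e2 h1 h2 ne I12 / v \in e1.
    move=> W; have [v1|v1] := boolP (v \in e1); first by have := W _ _ h1 h2 ne I12 v1; rewrite v1.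
    have [v2|v2] := boolP (v \in e2); last first.
      by apply: pc => //; apply: edges_in_setU1_notin; eassumption.
    have := W _ _ h2 h1; rewrite eq_sym setIC (negPf v1) v2 => /(_ ne I12 isT).
    by rewrite eq_sym.
  rewrite v1; case: (boolP (v \in e2)) => [v2|v2].
    case: (eqVneq e1 [set v; a]) => [e1a|_]; case: (eqVneq e2 [set v; a]) => [e2a|_].
    + by rewrite e1a e2a eqxx in ne.
    + by apply/eqP/nesym/fresh_neq.
    + by apply/eqP/fresh_neq.
    + by apply: contraNneq ne => /fresh_inj ->.
  case: (eqVneq e1 [set v; a]) => [e1a|_]; last by apply/eqP/fresh_neq.
  rewrite eq_sym; apply: meet; first by apply: edges_in_setU1_notin; eassumption.
  case/set0Pn: I12 => x; rewrite inE e1a => /andP[/set2P[->|-> //]].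
  by rewrite (negPf v2).
- move=> Q QK QS; have [vQ|vQ] := boolP (v \in Q).
    have QN : Q :\ v = [set a; b; d].
      have := clique4_nbrs QK vQ QS; rewrite Nv => QN; apply/eqP; rewrite eqEcard QN.
      case/andP: QK => /eqP; rewrite (cardsD1 v) vQ add1n => -[->] _.
      by rewrite -setUA !cardsU1 cards1; do !case: (_ \notin _).
    have inQ x : x \in [set a; b; d] -> x \in Q by rewrite -QN inE => /andP[].
    have [aQ bQ dQ] : [/\ a \in Q, b \in Q & d \in Q] by split; apply: inQ; rewrite !inE eqxx ?orbT.
    have nev x : x \in S -> v != x by move=> xS; apply: contraNneq vS => ->.
    have nvbd : v \notin [set b; d] by rewrite !inE negb_or !nev.
    exists [set v; a], [set b; d]; split; rewrite ?pair_in_pairs ?nev //.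
      by apply: contraNneq nvbd => <-; rewrite !inE eqxx.
    by rewrite /col_step (negPf nvbd) !inE !eqxx.
  have QS' : Q \subset S.
    apply/subsetP=> x xQ; have := subsetP QS x xQ; rewrite !inE.
    by case: eqP => // xv; rewrite -xv xQ in vQ.
  have [e1 [e2 [h1 h2 ne ce]]] := nr Q QK QS'.
  have nv e : e \in pairs Q -> (v \in e) = false.
    by rewrite !inE => /andP[eQ _]; apply: contraNF vQ => /(subsetP eQ).
  by exists e1, e2; rewrite /col_step !nv.
- move=> e1 e2 h1 h2 ne; rewrite /col_step inE.
  case: (boolP (v \in e1)) => [v1|v1]; case: (boolP (v \in e2)) => [v2|v2].
  + case: (eqVneq e1 [set v; a]) => [e1a|_]; first by rewrite eqxx.
    case: (eqVneq e2 [set v; a]) => [e2a|_]; first by move/fresh_neq.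
    by move/fresh_inj=> e12; rewrite e12 eqxx in ne.
  + by case: (eqVneq e1 [set v; a]) => [e1a|_]; [rewrite eqxx|move/fresh_neq].
  + by case: (eqVneq e2 [set v; a]) => [e1a|_]; [move=> ->; rewrite eqxx|move/esym/fresh_neq].
  + move=> ce; apply/orP; right; apply: (hM e1 e2) => //; apply: edges_in_setU1_notin; eassumption.
Qed.

(** The bound [m] on repeated colours governs further gluing: a vertex closing a triangle to a K_4
    has three candidate edges for a repetition, and only a colour already repeated can block one of
    them. *)
Definition colourable n (E : {set {set 'I_n}}) (S : {set 'I_n}) (m : nat) : Prop :=
  exists c M, size M <= m /\ good_col E S c M.

Lemma colourable_le n (E : {set {set 'I_n}}) (S : {set 'I_n}) m m' :
  m <= m' -> colourable E S m -> colourable E S m'.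
Proof. by move=> mm [c [M [sM g]]]; exists c, M; split=> //; apply: leq_trans mm. Qed.

(* If all three choices of [va] were blocked, the three edges of the triangle
   would carry three distinct repeated colours. *)
Lemma colourable_step n (E : {set {set 'I_n}}) (S : {set 'I_n}) m v a b d :
  is_graph E -> v \notin S -> m <= 2 -> colourable E S m ->
  a != b -> a != d -> b != d -> nbrs E v S = [set a; b; d] ->
  [set a; b] \in E -> [set a; d] \in E -> [set b; d] \in E ->
  colourable E (v |: S) m.+1.
Proof.
move=> EG vS m2 [c [M [sM g]]] ab ad bd Nv abE adE bdE.
have [aS bS dS] : [/\ a \in S, b \in S & d \in S].
  have inN x : x \in [set a; b; d] -> x \in S by rewrite -Nv inE => /andP[].
  by split; apply: inN; rewrite !inE eqxx ?orbT.
have done (x y z : 'I_n) : x != y -> x != z -> y != z -> [set a; b; d] = [set x; y; z] ->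
    [set y; z] \in E ->
    (forall w, w \in S -> [set x; w] \in E -> c [set x; w] != c [set y; z]) ->
    colourable E (v |: S) m.+1.
  move=> xy xz yz exyz yzE free; rewrite exyz in Nv.
  by exists (col_step c v x (c [set y; z])), (c [set y; z] :: M); split=> //; apply: good_col_step.
have blocked (x y z : 'I_n) : x \in S -> y \in S -> z \in S -> x != y -> x != z -> [set y;
  z] \in E ->
   ~~ [forall w, (w \in S) && ([set x; w] \in E) ==> (c [set x; w] != c [set y; z])] ->
   c [set y; z] \in M.
  move=> xS yS zS xy xz yzE /forallPn[w]; rewrite negb_imply negbK => /andP[/andP[wS xwE] /eqP cc].
  rewrite -cc; case: g => _ _ hM; apply: (hM _ [set y; z]); rewrite ?inE ?xwE ?yzE //.
  - by apply/subsetP=> u /set2P[]->.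
  - by apply/subsetP=> u /set2P[]->.
  - have: x \in [set x; w] by rewrite !inE eqxx.
    by apply: contraTneq => ->; rewrite !inE negb_or xy.
have [/forallP f1|/blocked B1] := boolP [forall w, (w \in S) && ([set a; w] \in E) ==> (c [set a;
  w] != c [set b; d])].
  by apply: (done a b d) => // w wS wE; have := f1 w; rewrite wS wE.
have [/forallP f2|/blocked B2] := boolP [forall w, (w \in S) && ([set b; w] \in E) ==> (c [set b;
  w] != c [set a; d])].
  apply: (done b a d); rewrite 1?eq_sym // 1?eq_sym //; first by rewrite [[set a; b]]setUC.
  by move=> w wS wE; have := f2 w; rewrite wS wE.
have [/forallP f3|/blocked B3] := boolP [forall w, (w \in S) && ([set d; w] \in E) ==> (c [set d;
  w] != c [set a; b])].
  apply: (done d a b); rewrite 1?eq_sym // 1?eq_sym //; first by rewrite setUC setUA.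
  by move=> w wS wE; have := f3 w; rewrite wS wE.
have uM : uniq [:: c [set b; d]; c [set a; d]; c [set a; b]].
  case: g => pc _ _.
  have pr (x y z : 'I_n) : x \in S -> y \in S -> z \in S -> [set x; y] \in E -> [set x;
    z] \in E -> y != z ->
      c [set x; y] != c [set x; z].
    move=> xS yS zS xyE xzE yz; apply: pc; rewrite ?inE ?xyE ?xzE.
    - by apply/subsetP=> u /set2P[]->.
    - by apply/subsetP=> u /set2P[]->.
    - by apply: contraNneq yz => /set2_inj ->.
    - by apply: (set2I_neq0 (x := x)); rewrite !inE eqxx.
  rewrite /= !inE !negb_or !andbT; apply/andP; split; first apply/andP; first split.
  - by rewrite [[set b; d]]setUC [[set a; d]]setUC pr // 1?setUC // eq_sym.
  - by rewrite [[set a; b]]setUC pr // 1?setUC // eq_sym.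
  - by rewrite pr // eq_sym.
have : 3 <= size M.
  apply: (uniq_leq_size uM) => k; rewrite !inE => /or3P[]/eqP ->.
  - by apply: B1.
  - by apply: B2; rewrite // eq_sym.
  - by apply: B3; rewrite // eq_sym.
by move=> h; have := leq_trans (leq_trans h sM) m2.
Qed.

(** In the new K_4 the edge [qp] is opposite to [ab] and takes its colour. All other edges at [p]
    and [q] are fresh, so nothing clashes and no colour other than that of [ab] becomes repeated. *)
Lemma good_col_edge_step n (E : {set {set 'I_n}}) (S : {set 'I_n}) c M p q a b :
  is_graph E -> p \notin S -> q \notin S -> p != q -> good_col E S c M ->
  a != b -> nbrs E q S = [set a; b] -> [set a; b] \in E ->
  [set p; a] \in E -> [set p; b] \in E -> [set q; p] \in E ->
  (forall Q, clique4 E Q -> Q \subset p |: S -> p \notin Q) ->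
  exists c', good_col E (q |: (p |: S)) c' (c [set a; b] :: M).
Proof.
move=> EG pS qS pq g ab Nq abE paE pbE qpE nQ.
have [aS bS] : a \in S /\ b \in S.
  have inN x : x \in [set a; b] -> x \in S by rewrite -Nq inE => /andP[].
  by split; apply: inN; rewrite !inE eqxx ?orbT.
have npx x : x \in S -> p != x by move=> xS; apply: contraNneq pS => ->.
have npab : p \notin [set a; b] by rewrite !inE negb_or !npx.
have g1 := good_col_isolated pS g nQ.
set c1 := (fun e => _) in g1.
have cab : c1 [set a; b] = c [set a; b] by rewrite /c1 (negPf npab).
exists (col_step c1 q p (c1 [set a; b])); rewrite -cab.
apply: good_col_step => //; rewrite ?npx //.
- by rewrite !inE negb_or eq_sym pq.
- apply/setP=> x; have := congr1 (fun A : {set 'I_n} => x \in A) Nq.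
  rewrite /nbrs !inE; case: (eqVneq x p) => [->|_] /=; first by rewrite qpE.
  by move=> ->.
- move=> x _ _; rewrite cab /c1 !inE eqxx /=; exact/eqP/fresh_neq.
Qed.

(** One pair of opposite edges is enough, and it may contain any prescribed edge; a later gluing
    along that edge then reuses the same repeated colour. *)
Lemma good_col_clique4 n (E : {set {set 'I_n}}) (S : {set 'I_n}) a b :
  clique4 E S -> a \in S -> b \in S -> a != b ->
  exists c, good_col E S c [:: c [set a; b]].
Proof.
move=> SK aS bS ab; pose opp := S :\: [set a; b].
have sub : [set a; b] \subset S by apply/subsetP=> x /set2P[]->.
have card_opp : #|opp| = 2.
  by case/andP: SK => /eqP c4 _; rewrite cardsDS // c4 cards2 ab.
have ne : [set a; b] != opp.
  by apply/eqP=> /setP/(_ a); rewrite !inE eqxx.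
have dis : [set a; b] :&: opp = set0.
  by apply/setP=> x; rewrite !inE; case: (_ || _).
pose c (e : {set 'I_n}) := if (e == [set a; b]) || (e == opp) then 0 else (enum_rank e).+1.
have c0 : c [set a; b] = 0 by rewrite /c eqxx.
exists c; rewrite c0; split.
- move=> e1 e2 _ _ ne12 I12; rewrite /c.
  case: ifP => [/orP[]/eqP e1a|_]; case: ifP => [/orP[]/eqP e2a|_] //.
  + by rewrite e1a e2a eqxx in ne12.
  + by rewrite e1a e2a dis eqxx in I12.
  + by rewrite e1a e2a setIC dis eqxx in I12.
  + by rewrite e1a e2a eqxx in ne12.
  + by rewrite eqSS; apply: contraNneq ne12 => /ord_inj/enum_rank_inj ->.
- move=> Q /andP[/eqP cQ _] QS; have -> : Q = S.
    by apply/eqP; rewrite eqEcard QS cQ; case/andP: SK => /eqP ->.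
  exists [set a; b], opp; split=> //; first exact: pair_in_pairs.
    by rewrite !inE card_opp eqxx subsetDl.
  by rewrite /c !eqxx orbT.
- move=> e1 e2 _ _ ne12; rewrite /c.
  case: ifP => // _; case: ifP => // _ [] /ord_inj/enum_rank_inj e12.
  by rewrite e12 eqxx in ne12.
Qed.

Lemma cards3P (T : finType) (A : {set T}) :
  #|A| = 3 -> exists a b d, [/\ a != b, a != d, b != d & A = [set a; b; d]].
Proof.
move=> A3; have /card_gt0P[a aA] : 0 < #|A| by rewrite A3.
have : #|A :\ a| == 2 by move: A3; rewrite (cardsD1 a) aA add1n => -[->].
case/cards2P=> b [d [bd Aa]]; exists a, b, d.
have [ba da] : b != a /\ d != a.
  have inA x : x \in [set b; d] -> x != a by rewrite -Aa !inE => /andP[].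
  by split; apply: inA; rewrite !inE eqxx ?orbT.
split; rewrite // 1?eq_sym //.
by rewrite -(setD1K aA) Aa setUA.
Qed.

(** Vertices are placed in Z/5 and an edge is coloured by the sum of its ends. If [m] is omitted,
    the two pairs symmetric about [m] both have sum [2 * m]. This serves a vertex joined to all of a
    K_4, where the step for three neighbours does not apply. *)
Lemma colourable_K5 n (E : {set {set 'I_n}}) (S : {set 'I_n}) :
  is_graph E -> #|S| = 5 -> exists m, colourable E S m.
Proof.
move=> EG S5.
have [x0 _] : exists x, x \in S by apply/card_gt0P; rewrite S5.
pose s := enum S; have us : uniq s := enum_uniq S.
have ss : size s = 5 by rewrite -cardE.
pose c (e : {set 'I_n}) := (\sum_(x in e) index x s) %% 5.
have c2 x y : x != y -> c [set x; y] = (index x s + index y s) %% 5.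
  by move=> xy; rewrite /c big_setU1 ?inE // big_set1.
have ix x : x \in S -> index x s < 5 by move=> xS; rewrite -ss index_mem mem_enum.
exists 5, c, (iota 0 5); split=> //; split.
- move=> e1 e2; rewrite !inE => /andP[e1E e1S] /andP[e2E e2S] ne /set0Pn[x].
  rewrite inE => /andP[x1 x2].
  have other e : e \in E -> e \subset S -> x \in e -> exists y, [/\ y \in S, x != y & e = [set x;
    y]].
    move=> eE eS xe; have := subsetP EG e eE; rewrite inE => /cards2P[a [b [ab ee]]].
    have [aS bS] : a \in S /\ b \in S by split; apply: (subsetP eS); rewrite ee !inE eqxx ?orbT.
    move: xe; rewrite ee => /set2P[->|->]; first by exists b.
    by exists a; rewrite eq_sym setUC.
  have [y [yS xy e1y]] := other _ e1E e1S x1; have [z [zS xz e2z]] := other _ e2E e2S x2.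
  have xS : x \in S by apply: (subsetP e1S).
  rewrite e1y e2z !c2 // eqn_modDl !modn_small ?ix //.
  apply: contraNneq ne => /index_inj-/(_ _) yz; rewrite e1y e2z.
  by rewrite (yz x0) ?mem_enum.
- move=> Q /andP[/eqP Q4 _] QS.
  have /cards1P[m Dm] : #|S :\: Q| == 1 by rewrite cardsDS // Q4 S5.
  have mD : m \in S :\: Q by rewrite Dm inE.
  have [mS mQ] : m \in S /\ m \notin Q by move: mD; rewrite inE => /andP[].
  have inQ x : x \in S -> x != m -> x \in Q.
    by move=> xS xm; apply: contraNT xm => xQ; rewrite -in_set1 -Dm inE xQ.
  pose v i := nth x0 s i.
  have vS i : i < 5 -> v i \in S by move=> i5; rewrite -mem_enum mem_nth ?ss.
  have vne i j : i < 5 -> j < 5 -> i != j -> v i != v j by move=> ? ? ?; rewrite nth_uniq ?ss.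
  have vix i : i < 5 -> index (v i) s = i by move=> ?; rewrite index_uniq ?ss.
  have mv : m = v (index m s) by rewrite /v nth_index ?mem_enum.
  have sol i j k l : uniq [:: i; j; k; l; index m s] -> all (fun i => i < 5) [:: i; j; k; l] ->
     (i + j) %% 5 = (k + l) %% 5 -> nonrainbow c Q.
    move=> u /and5P[i5 j5 k5 l5 _] eqs.
    have im : index m s < 5 by rewrite ix.
    move: u; rewrite /= !inE !negb_or !andbT => /and4P[/and4P[ij ik il im'] /and3P[jk jl jm]
      /andP[kl km] lm].
    have neqm a : a < 5 -> a != index m s -> v a != m by move=> a5 am; rewrite mv vne.
    exists [set v i; v j], [set v k; v l]; split.
    + by apply: pair_in_pairs; rewrite ?inQ ?vS ?neqm ?vne.
    + by apply: pair_in_pairs; rewrite ?inQ ?vS ?neqm ?vne.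
    + apply/eqP=> /setP/(_ (v i)); rewrite !inE eqxx /=.
      by rewrite (negPf (vne _ _ _ _ ik)) ?(negPf (vne _ _ _ _ il)).
    + by rewrite !c2 ?vne // !vix.
  case: (index m s) (ix m mS) sol => [|[|[|[|[|]]]]] // _ sol.
  + exact: (sol 1 4 2 3).
  + exact: (sol 0 2 3 4).
  + exact: (sol 1 3 0 4).
  + exact: (sol 2 4 0 1).
  + exact: (sol 0 3 1 2).
- by move=> e1 e2 _ _ _ _; rewrite mem_iota /= add0n ltn_mod.
Qed.

Lemma colourable_step_clique n (E : {set {set 'I_n}}) (S Q : {set 'I_n}) m v :
  is_graph E -> v \notin S -> m <= 2 -> colourable E S m ->
  clique4 E Q -> v \in Q -> Q \subset v |: S -> #|nbrs E v S| = 3 ->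
  colourable E (v |: S) m.+1.
Proof.
move=> EG vS m2 colS QK vQ QS N3.
have QN : Q :\ v = nbrs E v S.
  apply/eqP; rewrite eqEcard clique4_nbrs // N3.
  by case/andP: QK => /eqP; rewrite (cardsD1 v) vQ add1n => -[->].
have [a [b [d [ab ad bd Nv]]]] := cards3P N3.
have inQ x : x \in [set a; b; d] -> x \in Q by rewrite -Nv -QN inE => /andP[].
have [aQ bQ dQ] : [/\ a \in Q, b \in Q & d \in Q] by split; apply: inQ; rewrite !inE eqxx ?orbT.
by apply: (colourable_step EG vS m2 colS ab ad bd Nv); apply: (clique4_adj QK).
Qed.

Lemma card_pairs (T : finType) (S : {set T}) : #|pairs S| = 'C(#|S|, 2).
Proof. by rewrite -cards_draws; apply: eq_card => e; rewrite !inE. Qed.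

Lemma card_edges_clique4 n (E : {set {set 'I_n}}) (Q : {set 'I_n}) :
  is_graph E -> clique4 E Q -> #|edges_in E Q| = 6.
Proof.
move=> EG /andP[/eqP Q4 QE].
rewrite -[RHS](_ : 'C(4, 2) = 6) // -Q4 -card_pairs; apply: eq_card => e.
rewrite !inE andbC; case: (boolP (e \subset Q)) => //= eQ.
apply/idP/idP => [/(subsetP EG)|e2]; first by rewrite inE.
by apply: (subsetP QE); rewrite !inE eQ.
Qed.

(* The colour class used on the first clique is chosen to contain the edge
   [ab], so that the two clique colourings share their repeated colour. *)
Lemma colourable_K4_edge_triangle n (E : {set {set 'I_n}}) (Q : {set 'I_n}) v p q a b :
  is_graph E -> clique4 E Q -> v \notin Q -> #|nbrs E v Q| = 3 ->
  p \notin v |: Q -> q \notin v |: Q -> p != q -> a \in Q -> b \in Q -> a != b ->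
  nbrs E p (v |: Q) = [set a; b] -> nbrs E q (v |: Q) = [set a; b] -> [set q; p] \in E ->
  colourable E (q |: (p |: (v |: Q))) 2.
Proof.
move=> EG QK vQ N3 pS qS pq aQ bQ ab Np Nq qpE.
have [pQ pv] : p \notin Q /\ p != v by move: pS; rewrite !inE negb_or => /andP[].
have [qQ qv] : q \notin Q /\ q != v by move: qS; rewrite !inE negb_or => /andP[].
have abE : [set a; b] \in E by apply: (clique4_adj QK).
have [va vb] : v != a /\ v != b by split; apply: contraNneq vQ => ->.
have restr x : nbrs E x (v |: Q) = [set a; b] -> nbrs E x Q = [set a; b] /\ [set x; v] \notin E.
  move=> Nx; split.
    apply/setP=> y; rewrite -Nx !inE; case: (eqVneq y v) => [->|//].
    rewrite (negPf vQ) /=; apply/esym/negbTE; have := congr1 (fun A : {set 'I_n} => v \in A) Nx.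
    by rewrite !inE eqxx (negPf va) (negPf vb) /= => ->.
  by have := congr1 (fun A : {set 'I_n} => v \in A) Nx;
    rewrite !inE eqxx (negPf va) (negPf vb) /= => ->.
have [NpQ vpE] := restr p Np; have [NqQ vqE] := restr q Nq.
have adj x y : nbrs E x Q = [set a; b] -> y \in [set a; b] -> [set x; y] \in E.
  by move=> <-; rewrite inE => /andP[].
have [c g] := good_col_clique4 QK aQ bQ ab.
have [|||Q' Q'K Q'S|c' g'] := good_col_edge_step (p := p) (q := q) EG pQ qQ pq g ab NqQ abE.
- by apply: adj NpQ _; rewrite !inE eqxx.
- by apply: adj NpQ _; rewrite !inE eqxx orbT.
- done.
- apply/negP=> pQ'; have := subset_leq_card (clique4_nbrs Q'K pQ' Q'S).
  rewrite NpQ cards2 ab; case/andP: Q'K => /eqP.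
  by rewrite (cardsD1 p) pQ' add1n => -[->].
(* [v] is added last: the clique and the edge [pq] together repeat only the colour of [ab], so the
   vertex step starts from one repeated colour. It is unaffected by [p] and [q], neither of which is
   adjacent to [v]. *)
have -> : q |: (p |: (v |: Q)) = v |: (q |: (p |: Q)).
  by apply/setP=> x; rewrite !inE; case: (x == q); case: (x == p); case: (x == v).
have Nv : nbrs E v (q |: (p |: Q)) = nbrs E v Q.
  apply/setP=> x; rewrite !inE; case: (eqVneq x q) => [->|_] /=.
    by rewrite setUC (negPf vqE) andbF.
  case: (eqVneq x p) => [->|//] /=.
  by rewrite setUC (negPf vpE) andbF.
have [x [y [z [xy xz yz Nxyz]]]] := cards3P N3.
have inQ w : w \in [set x; y; z] -> w \in Q by rewrite -Nxyz inE => /andP[].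
have [xQ yQ zQ] : [/\ x \in Q, y \in Q & z \in Q] by split; apply: inQ; rewrite !inE eqxx ?orbT.
apply: (@colourable_step _ E _ 1 v x y z) => //; rewrite ?(clique4_adj QK) //.
- by rewrite !inE !negb_or ![v == _]eq_sym pv qv.
- exists c', [:: c [set a; b]]; split=> //; apply: good_col_sub g' _.
  by move=> k; rewrite !inE orbb.
- by rewrite Nv.
Qed.

(* [phi = 15 v - 7 e] is the potential of [S]; the cliques glued so far leave
   [phi = 18] after one clique, [13] and [12] after gluing a second one along an
   edge or a triangle, and at most [8] later on. *)
Definition cluster n (E : {set {set 'I_n}}) (S : {set 'I_n}) : Prop :=
  exists phi, [/\ 15 * #|S| = 7 * #|edges_in E S| + phi, 2 * phi + 5 * #|S| <= 56 &
   [\/ phi = 18 /\ clique4 E S,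
       phi = 13 /\ colourable E S 1,
       phi = 12 /\ (exists Q v, [/\ clique4 E Q, v \notin Q, S = v |: Q & #|nbrs E v Q| = 3]) |
       [/\ phi <= 8, 7 <= phi -> colourable E S 2 & exists m, colourable E S m]]].

Lemma colourable_clique4 n (E : {set {set 'I_n}}) (S : {set 'I_n}) :
  clique4 E S -> colourable E S 1.
Proof.
move=> SK; have : 1 < #|S| by case/andP: SK => /eqP ->.
case/card_gt1P=> a [b [aS bS ab]]; have [c g] := good_col_clique4 SK aS bS ab.
by exists c, [:: c [set a; b]].
Qed.

Lemma colourable_clique4_setU1 n (E : {set {set 'I_n}}) (Q : {set 'I_n}) v :
  is_graph E -> clique4 E Q -> v \notin Q -> #|nbrs E v Q| = 3 -> colourable E (v |: Q) 2.
Proof.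
move=> EG QK vQ N3; have [a [b [d [ab ad bd Nv]]]] := cards3P N3.
have inQ w : w \in [set a; b; d] -> w \in Q by rewrite -Nv inE => /andP[].
have [aQ bQ dQ] : [/\ a \in Q, b \in Q & d \in Q] by split; apply: inQ; rewrite !inE eqxx ?orbT.
by apply: (colourable_step EG vQ _ (colourable_clique4 QK) ab ad bd Nv); rewrite ?(clique4_adj QK).
Qed.

Lemma cluster_colourable n (E : {set {set 'I_n}}) (S : {set 'I_n}) :
  is_graph E -> cluster E S -> exists m, colourable E S m.
Proof.
move=> EG [phi [_ _ [[_ SK]|[_ cS]|[_ [Q [v [QK vQ -> N3]]]]|[_ _ //]]]].
- by exists 1; apply: colourable_clique4.
- by exists 1.
- by exists 2; apply: colourable_clique4_setU1.
Qed.

(** A vertex with [k] neighbours changes [phi] by [15 - 7 * k], and sparsity keeps [phi] positive: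
    [k = 3] costs 6, and [k = 4], costing 13, is affordable only from a single K_4, which becomes
    K_5. *)
Lemma cluster_vertex_step n (E : {set {set 'I_n}}) (S Q : {set 'I_n}) v :
  is_graph E -> sparse 7 15 13 E -> cluster E S -> clique4 E Q ->
  v \notin S -> v \in Q -> Q \subset v |: S -> cluster E (v |: S).
Proof.
move=> EG sE [phi [hphi h56 st]] QK vS vQ QS.
have cS' : #|v |: S| = #|S|.+1 by rewrite cardsU1 vS.
have eS' := card_edges_in_setU1 EG vS.
have N3 : 3 <= #|nbrs E v S|.
  apply: leq_trans (subset_leq_card (clique4_nbrs QK vQ QS)).
  by case/andP: QK => /eqP; rewrite (cardsD1 v) vQ add1n => -[->].
have := forallP sE (v |: S); rewrite cS' eS'.
set k := #|nbrs E v S| in N3 eS' *; set s := #|S| in hphi h56 cS' *.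
set e := #|edges_in E S| in hphi eS' *.
(* The invariant [2 * phi + 5 * #|S| <= 56] gives at most 11 vertices, so the enlarged set is within
   the range 13 of the sparsity. It is an equality for one K_4, and an edge gluing of cost 5 keeps
   its left side unchanged. *)
move=> /implyP-/(_ _) sp; have {}sp : 7 * (e + k) < 15 * s.+1.
  by apply: sp; move: h56; clear; lia.
have next m : k = 3 -> m <= 2 -> colourable E S m -> colourable E (v |: S) m.+1.
  by move=> k3 m2 col; apply: (colourable_step_clique EG vS m2 col QK vQ QS).
exists (phi + 15 - 7 * k); split; try (rewrite cS' ?eS'; clear -hphi sp h56 N3; lia).
case: st => [[p18 SK]|[p13 col]|[p12 [Q' [v' [QK' vQ' eS N3']]]]|[p8 col7 colm]].
- have [k3|k4] : k = 3 \/ k = 4 by clear -hphi sp p18 N3; lia.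
    by constructor 3; split; [rewrite p18 k3|exists S, v].
  constructor 4; split; rewrite ?p18 ?k4 //.
  apply: colourable_K5 => //; rewrite cS'.
  by case/andP: SK => /eqP; rewrite -/s => ->.
- have k3 : k = 3 by clear -hphi sp p13 N3; lia.
  constructor 4; split; rewrite ?p13 ?k3 //; first by move=> _; apply: (next 1).
  by exists 2; apply: (next 1).
- have k3 : k = 3 by clear -hphi sp p12 N3; lia.
  constructor 4; split; rewrite ?p12 ?k3 //; exists 3; apply: (next 2) => //.
  by rewrite eS; apply: colourable_clique4_setU1.
- have [k3 p7] : k = 3 /\ 7 <= phi by clear -hphi sp p8 N3; lia.
  constructor 4; split; rewrite ?k3; try (clear -p8; lia).
  by exists 3; apply: (next 2) => //; apply: col7.
Qed.

Lemma nbrs_setU1 n (E : {set {set 'I_n}}) (S : {set 'I_n}) p q :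
  [set q; p] \in E -> nbrs E q (p |: S) = p |: nbrs E q S.
Proof. by move=> qpE; apply/setP=> x; rewrite !inE; case: eqP => // ->; rewrite qpE. Qed.

(** With [k] and [l] neighbours in [S], the edge [pq] costs [7 * (k + l + 1) - 30]: this is 5 for
    degrees 2 and 2, 12 for 3 and 2, and at least 19 otherwise, more than the largest potential
    18. *)
Lemma cluster_edge_step n (E : {set {set 'I_n}}) (S Q : {set 'I_n}) p q :
  is_graph E -> sparse 7 15 13 E -> cluster E S -> clique4 E Q ->
  p \notin S -> q \notin S -> p != q -> p \in Q -> q \in Q -> Q \subset q |: (p |: S) ->
  cluster E (q |: (p |: S)).
Proof.
move=> EG sE; wlog kpq : p q / #|nbrs E q S| <= #|nbrs E p S|.
  move=> W clS QK pS qS pq pQ qQ QS.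
  case/orP: (leq_total #|nbrs E q S| #|nbrs E p S|) => kk; first exact: W.
  by rewrite setUCA; apply: W; rewrite // 1?eq_sym // setUCA.
move=> [phi [hphi h56 st]] QK pS qS pq pQ qQ QS.
have qpE : [set q; p] \in E by rewrite (clique4_adj QK) // eq_sym.
have qpS : q \notin p |: S by rewrite !inE negb_or eq_sym pq.
have cS' : #|q |: (p |: S)| = #|S|.+2 by rewrite !cardsU1 qpS pS.
have pN : p \notin nbrs E q S by rewrite !inE (negPf pS).
have eS' : #|edges_in E (q |: (p |: S))| = #|edges_in E S| + #|nbrs E p S| + #|nbrs E q S|.+1.
  by rewrite !card_edges_in_setU1 // nbrs_setU1 // cardsU1 pN.
have : #|Q :\ p :\ q| == 2.
  have qQp : q \in Q :\ p by rewrite in_setD1 eq_sym pq.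
  have : #|Q :\ p| = 3 by case/andP: QK => /eqP; rewrite (cardsD1 p) pQ add1n => -[->].
  by rewrite (cardsD1 q) qQp add1n => -[->].
case/cards2P=> a [b [ab Qab]].
have [aQ' bQ'] : a \in Q :\ p :\ q /\ b \in Q :\ p :\ q by rewrite Qab !inE !eqxx orbT.
have [aQ ap aq] : [/\ a \in Q, a != p & a != q] by move: aQ'; rewrite !inE => /and3P[].
have [bQ bp bq] : [/\ b \in Q, b != p & b != q] by move: bQ'; rewrite !inE => /and3P[].
have aS : a \in S by have := subsetP QS a aQ; rewrite !inE (negPf ap) (negPf aq).
have bS : b \in S by have := subsetP QS b bQ; rewrite !inE (negPf bp) (negPf bq).
have adj := clique4_adj QK.
have [paE pbE] : [set p; a] \in E /\ [set p; b] \in E by rewrite !adj // eq_sym.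
have [qaE qbE] : [set q; a] \in E /\ [set q; b] \in E by rewrite !adj // eq_sym.
have abE : [set a; b] \in E by rewrite adj.
have abN x : [set x; a] \in E -> [set x; b] \in E -> [set a; b] \subset nbrs E x S.
  by move=> xa xb; apply/subsetP=> y /set2P[]->; rewrite inE ?aS ?bS ?xa ?xb.
have k2 x : [set x; a] \in E -> [set x; b] \in E -> 2 <= #|nbrs E x S|.
  by move=> xa xb; have := subset_leq_card (abN x xa xb); rewrite cards2 ab.
have Nx x : [set x; a] \in E -> [set x; b] \in E -> #|nbrs E x S| = 2 -> nbrs E x S = [set a; b].
  by move=> xa xb N2; apply/esym/eqP; rewrite eqEcard abN // cards2 ab N2.
have kq := k2 q qaE qbE; have kp := k2 p paE pbE.
have edge_step c M : good_col E S c M -> #|nbrs E q S| = 2 ->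
    (forall Q, clique4 E Q -> Q \subset p |: S -> p \notin Q) ->
    exists c', good_col E (q |: (p |: S)) c' (c [set a; b] :: M).
  move=> g q2 nQ; apply: (@good_col_edge_step n E S c M p q a b) => //; exact: Nx.
have nQ2 : #|nbrs E p S| = 2 -> forall Q, clique4 E Q -> Q \subset p |: S -> p \notin Q.
  move=> p2 Q' QK' QS'; apply/negP=> pQ'; have := subset_leq_card (clique4_nbrs QK' pQ' QS').
  by rewrite p2; case/andP: QK' => /eqP; rewrite (cardsD1 p) pQ' add1n => -[->].
have edge_col m : colourable E S m -> #|nbrs E q S| = 2 -> #|nbrs E p S| = 2 ->
    colourable E (q |: (p |: S)) m.+1.
  move=> [c [M [sM g]]] q2 p2; have [c' g'] := edge_step c M g q2 (nQ2 p2).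
  by exists c', (c [set a; b] :: M).
(* With three neighbours [p] may itself close a K_4 with [S]; then [p] and [q] are two vertex steps,
   [q] having the neighbours [p], [a], [b]. Otherwise the edges at [p] may be fresh and the edge
   step applies. *)
have edge_col3 m : m <= 1 -> colourable E S m -> #|nbrs E q S| = 2 -> #|nbrs E p S| = 3 ->
    colourable E (q |: (p |: S)) m.+2.
  move=> m1 col q2 p3.
  have [/existsP[Q' /and3P[QK' QS' pQ']]|/existsPn nQ] :=
    boolP [exists Q', [&& clique4 E Q', Q' \subset p |: S & p \in Q']].
    have col1 := colourable_step_clique EG pS (leqW m1) col QK' pQ' QS' p3.
    apply: (colourable_step_clique EG qpS _ col1 QK qQ QS) => //.
    by rewrite nbrs_setU1 // cardsU1 pN q2.
  apply: (@colourable_le _ _ _ m.+1) => //.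
  case: col => c [M [sM g]]; have [|c' g'] := edge_step c M g q2.
    by move=> Q' QK' QS'; have := nQ Q'; rewrite QK' QS'.
  by exists c', (c [set a; b] :: M).
have := forallP sE (q |: (p |: S)); rewrite cS' eS'.
set k := #|nbrs E p S| in kp kpq eS' nQ2 edge_col edge_col3 *.
set l := #|nbrs E q S| in kq kpq eS' edge_step edge_col edge_col3 *.
set s := #|S| in hphi h56 cS' *; set e := #|edges_in E S| in hphi eS' *.
move=> /implyP-/(_ _) sp; have {}sp : 7 * (e + k + l.+1) < 15 * s.+2.
  by apply: sp; move: h56; clear; lia.
exists (phi + 30 - 7 * (k + l.+1)); split; try (rewrite cS' ?eS'; clear -hphi sp h56 kp kq; lia).
case: st => [[p18 SK]|[p13 col]|[p12 [Q' [v [QK' vQ' eS N3']]]]|[p8 col7 [m col]]].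
- have [l2 [k3|k3]] : l = 2 /\ (k = 2 \/ k = 3) by clear -hphi sp p18 kp kq kpq; lia.
    constructor 2; split; first by rewrite p18 l2 k3.
    have [c g] := good_col_clique4 SK aS bS ab.
    have [c' g'] := edge_step _ _ g l2 (nQ2 k3); exists c', [:: c [set a; b]]; split=> //.
    by apply: good_col_sub g' _ => x; rewrite !inE orbb.
  constructor 4; split; rewrite ?p18 ?l2 ?k3 //.
  by exists 3; apply: (edge_col3 1) => //; apply: colourable_clique4.
- have [l2 [k3|k3]] : l = 2 /\ (k = 2 \/ k = 3) by clear -hphi sp p13 kp kq kpq; lia.
    constructor 4; split; rewrite ?p13 ?l2 ?k3 //; first by move=> _; apply: (edge_col 1).
    by exists 2; apply: (edge_col 1).
  constructor 4; split; rewrite ?p13 ?l2 ?k3 //.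
  by exists 3; apply: (edge_col3 1).
- have [l2 k3] : l = 2 /\ k = 2 by clear -hphi sp p12 kp kq kpq; lia.
  have Np := Nx p paE pbE k3; have Nq := Nx q qaE qbE l2.
  (* [phi] drops to 7, so only two repeated colours are allowed, one fewer than gluing onto an
     arbitrary colouring of [S] would give. But [S] is two K_4s on a common triangle, and the edge
     [ab] lies in one of them; that one is coloured first. *)
  have colS : colourable E (q |: (p |: S)) 2.
    rewrite eS in aS bS pS qS Np Nq *.
    have special u (K : {set 'I_n}) : clique4 E K -> u \notin K -> v |: Q' = u |: K ->
        #|nbrs E u K| = 3 -> a \in K -> b \in K -> colourable E (q |: (p |: (v |: Q'))) 2.
      move=> KK uK eqK N3K aK bK; rewrite eqK in pS qS Np Nq *.
      exact: (@colourable_K4_edge_triangle n E K u p q a b).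
    have [x [y [z [xy xz yz Nxyz]]]] := cards3P N3'.
    pose T := nbrs E v Q'.
    have TQ : T \subset Q' by apply/subsetP=> w; rewrite inE => /andP[].
    (* [u] is the vertex of [Q'] not adjacent to [v]. Exchanging [u] and [v] exchanges the K_4s [Q']
       and [v |: T]. *)
    have [u Du] : exists u, Q' :\: T = [set u].
      by apply/cards1P; rewrite cardsDS // N3'; case/andP: QK' => /eqP ->.
    have [uQ uT] : u \in Q' /\ u \notin T.
      by have : u \in Q' :\: T; [rewrite Du inE|rewrite inE => /andP[]].
    have vu : v != u by apply: contraNneq vQ' => ->.
    have vT : v \notin T by apply: contraNN vQ'; apply: (subsetP TQ).
    have QuT : Q' = u |: T by rewrite -{1}(setID Q' T) (setIidPr TQ) Du setUC.
    have vuE : [set v; u] \notin E by move: uT; rewrite inE uQ.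
    have vTK : clique4 E (v |: T).
      rewrite /clique4 cardsU1 vT N3' /=; apply/subsetP=> f /pairsP[w [w' [wT wT' ww ->]]].
      have vadj w0 : w0 \in T -> [set v; w0] \in E by rewrite inE => /andP[].
      case/setU1P: wT ww => [->|wT] ww.
        by case/setU1P: wT' ww => [->|/vadj //]; rewrite eqxx.
      case/setU1P: wT' ww => [->|wT'] ww; first by rewrite setUC vadj.
      by apply: (clique4_adj QK') => //; apply: (subsetP TQ).
    have uvT : u \notin v |: T by rewrite in_setU1 negb_or eq_sym vu.
    have eqK : v |: Q' = u |: (v |: T) by rewrite QuT setUCA.
    have NuT : #|nbrs E u (v |: T)| = 3.
      rewrite -N3' -/T; apply: eq_card => w; rewrite inE in_setU1.
      case: (eqVneq w v) => [->|_] /=; first by rewrite setUC (negPf vuE) (negPf vT).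
      case: (boolP (w \in T)) => //= wT; apply: (clique4_adj QK') => //.
        exact: (subsetP TQ).
      by apply: contraNneq uT => ->.
    have inT w : w \in v |: Q' -> w != v -> [set v; w] \in E -> w \in v |: T.
      by rewrite !in_setU1 => /orP[/eqP->|wQ _ vwE]; [rewrite eqxx|rewrite inE wQ vwE orbT].
    have [va|va] := eqVneq v a; [|have [vb|vb] := eqVneq v b].
    - apply: (special u (v |: T)) => //; first by rewrite va setU11.
      by apply: inT; rewrite // va // eq_sym.
    - apply: (special u (v |: T)) => //; last by rewrite vb setU11.
      by apply: inT; rewrite // vb // setUC.
    - apply: (special v Q') => //.
      + by move: aS; rewrite !inE eq_sym (negPf va).
      + by move: bS; rewrite !inE eq_sym (negPf vb).
  by constructor 4; split; rewrite ?p12 ?l2 ?k3 //; exists 2.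
- have [l2 k3] : l = 2 /\ k = 2 by clear -hphi sp p8 kp kq kpq; lia.
  constructor 4; split; rewrite ?l2 ?k3; try (clear -p8; lia).
  by exists m.+1; apply: edge_col.
Qed.

Lemma cluster_step n (E : {set {set 'I_n}}) (S Q : {set 'I_n}) :
  is_graph E -> sparse 7 15 13 E -> cluster E S -> clique4 E Q ->
  2 <= #|Q :&: S| -> cluster E (S :|: Q).
Proof.
move=> EG sE clS QK QS2.
have cQ : #|Q :&: S| + #|Q :\: S| = 4 by rewrite cardsID; case/andP: QK => /eqP.
have SQ : S :|: Q = (Q :\: S) :|: S by rewrite setUC -[in LHS](setID Q S) -setUA [_ :|: S]setUC
  setUA (setUidPr (subsetIr _ _)) setUC.
have [D0|D1|D2] : [\/ #|Q :\: S| = 0, #|Q :\: S| = 1 | #|Q :\: S| = 2].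
  case: #|Q :\: S| cQ => [|[|[|k]]] cQ; [by constructor 1|by constructor 2|by constructor 3|].
  by move: QS2 cQ; clear; lia.
- by rewrite SQ (cards0_eq D0) set0U.
- have /cards1P[v Dv] : #|Q :\: S| == 1 by rewrite D1.
  have /setDP[vQ vS] : v \in Q :\: S by rewrite Dv inE.
  rewrite SQ Dv; apply: (cluster_vertex_step EG sE clS QK vS vQ).
  by rewrite -Dv -SQ subsetUr.
- have /cards2P[q [p [qp Dqp]]] : #|Q :\: S| == 2 by rewrite D2.
  have /setDP[pQ pS] : p \in Q :\: S by rewrite Dqp !inE eqxx orbT.
  have /setDP[qQ qS] : q \in Q :\: S by rewrite Dqp !inE eqxx.
  have eqS : S :|: Q = q |: (p |: S) by rewrite SQ Dqp setUA.
  rewrite eqS; apply: (cluster_edge_step EG sE clS QK) => //; first by rewrite eq_sym.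
  by rewrite -eqS subsetUr.
Qed.

Lemma cluster_clique4 n (E : {set {set 'I_n}}) (Q : {set 'I_n}) :
  is_graph E -> clique4 E Q -> cluster E Q.
Proof.
move=> EG QK; exists 18; rewrite (card_edges_clique4 EG QK).
by case/andP: (QK) => /eqP-> _; split=> //; constructor 1.
Qed.

(** Absorbing cliques that share an edge with the cluster must stop, since each of them adds a
    vertex. *)
Lemma closed_cluster n (E : {set {set 'I_n}}) (S : {set 'I_n}) :
  is_graph E -> sparse 7 15 13 E -> cluster E S ->
  exists S' : {set 'I_n}, [/\ S \subset S', cluster E S' &
    forall Q, clique4 E Q -> 2 <= #|Q :&: S'| -> Q \subset S'].
Proof.
move=> EG sE; elim: {S}_.+1 {-2}S (ltnSn #|~: S|) => // m IH S hS clS.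
have [/existsP[Q /and3P[QK Q2 QS]]|/existsPn cl] :=
  boolP [exists Q, [&& clique4 E Q, 2 <= #|Q :&: S| & ~~ (Q \subset S)]].
  have [||S' [sub cS' cl]] := IH (S :|: Q).
  - apply: leq_trans (_ : #|~: S| <= m); last by rewrite -ltnS.
    apply: proper_card; rewrite properC properE subsetUl /=.
    by apply: contra QS; apply: subset_trans (subsetUr _ _).
  - exact: cluster_step.
  by exists S'; split=> //; apply: subset_trans sub; apply: subsetUl.
exists S; split=> // Q QK Q2; have := cl Q; rewrite QK Q2 /=; by rewrite negbK.
Qed.

(** * Assembling the cluster colourings *)

Definition clique_link n (E : {set {set 'I_n}}) : rel {set 'I_n} :=
  fun Q Q' => [&& clique4 E Q, clique4 E Q' & 2 <= #|Q :&: Q'|].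

Lemma clique_component_colouring n (E : {set {set 'I_n}}) (Q : {set 'I_n}) :
  is_graph E -> sparse 7 15 13 E -> clique4 E Q ->
  exists (S : {set 'I_n}) c M, good_col E S c M /\ forall Q', connect (clique_link E) Q Q' -> Q'
    \subset S.
Proof.
move=> EG sE QK; have [S [QS clS cl]] := closed_cluster EG sE (cluster_clique4 EG QK).
have [m [c [M [_ g]]]] := cluster_colourable EG clS; exists S, c, M; split=> //.
move=> Q' /connectP[s pth ->]; elim: s Q QS {QK} pth => //= Q1 s IH Q QS /andP[/and3P[_ Q1K Q2]].
apply: IH; apply: cl => //; apply: leq_trans Q2 _.
by apply: subset_leq_card; rewrite setIC setIS.
Qed.

Lemma card_pairsI_ge2 (T : finType) (Q Q' e : {set T}) :
  #|e| == 2 -> e \subset Q -> e \subset Q' -> 2 <= #|Q :&: Q'|.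
Proof. by move=> /eqP <- eQ eQ'; apply: subset_leq_card; rewrite subsetI eQ. Qed.

(* Cliques sharing an edge get a common colouring, and different components of
   the sharing relation get disjoint palettes. *)
Lemma sparse_no_rainbow_K4 n (E : {set {set 'I_n}}) :
  is_graph E -> sparse 7 15 13 E ->
  exists c, proper_colouring E c /\ forall Q, clique4 E Q -> nonrainbow c Q.
Proof.
move=> EG sE.
have /fin_all_exists[col colP] (Q : {set 'I_n}) : exists c : {set 'I_n} -> nat, clique4 E Q ->
    exists (S : {set 'I_n}) M, good_col E S c M /\ forall Q', connect (clique_link E) Q Q' -> Q'
      \subset S.
  have [QK|] := boolP (clique4 E Q); last by exists (fun=> 0).
  have [S [c [M gS]]] := clique_component_colouring EG sE QK.
  by exists c => _; exists S, M.
have lsym : connect_sym (clique_link E).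
  apply: sym_connect_sym => Q Q'; rewrite /clique_link setIC; by rewrite andbCA.
pose rt := fingraph.root (clique_link E).
have rtK Q : clique4 E Q -> clique4 E (rt Q).
  have closedK : closed (clique_link E) (clique4 E).
    by move=> Q1 Q2 /and3P[k1 k2 _]; rewrite -!topredE /= k1 k2.
  by move=> QK; have := closed_connect closedK (connect_root (clique_link E) Q);
    rewrite -!topredE /= QK => <-.
have rt_eq Q Q' : clique4 E Q -> clique4 E Q' -> 2 <= #|Q :&: Q'| -> rt Q = rt Q'.
  by move=> QK QK' QQ; apply/(fingraph.rootP lsym)/connect1; rewrite /clique_link QK QK'.
(* The component does not depend on the K_4 picked, as two K_4s on a common edge are linked. An edge
   in no K_4 is its own colour. *)
pose tagcol (e : {set 'I_n}) : ({set 'I_n} * nat) + {set 'I_n} :=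
  if [pick Q | clique4 E Q && (e \subset Q)] is Some Q then inl (rt Q, col (rt Q) e) else inr e.
have tagcolE Q e : clique4 E Q -> e \in pairs Q -> tagcol e = inl (rt Q, col (rt Q) e).
  rewrite inE powersetE => QK /andP[eQ e2]; rewrite /tagcol;
    case: pickP => [Q' /andP[QK' eQ']|/(_ Q)]; last by rewrite QK eQ.
  by rewrite (rt_eq Q' Q) // (card_pairsI_ge2 e2).
exists (fun e => pickle (tagcol e)); split.
  move=> e1 e2 e1E e2E ne I12; rewrite (inj_eq (pcan_inj pickleK)).
  have card2 e : e \in E -> #|e| == 2 by move/(subsetP EG); rewrite inE.
  rewrite /tagcol; case: pickP => [Q1 /andP[QK1 eQ1]|_]; case: pickP => [Q2 /andP[QK2 eQ2]|_] //.
  apply/eqP => -[rr]; rewrite -rr; apply/eqP.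
  have [S [M [[pc _ _] sub]]] := colP _ (rtK Q1 QK1).
  apply: pc => //; rewrite inE ?e1E ?e2E /=.
    by apply: subset_trans eQ1 (sub _ _); rewrite lsym connect_root.
  by apply: subset_trans eQ2 (sub _ _); rewrite rr lsym connect_root.
move=> Q QK; have [S [M [[_ nr _] sub]]] := colP _ (rtK Q QK).
have [|e1 [e2 [h1 h2 ne ce]]] := nr Q QK; first by apply: sub; rewrite lsym connect_root.
by exists e1, e2; split=> //; rewrite !(tagcolE Q) // ce.
Qed.

(** * Colouring a bipartite graph plus small trees *)

(* Positions 0..3 of a tree with at most three edges: a star centred at 0
   ([t = true]) or the path 0-1-2-3 ([t = false]). *)
Definition tree_adj (t : bool) (i j : nat) : bool :=
  if t then (i == 0) != (j == 0) else (i == j.+1) || (j == i.+1).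

(** [s] is the sum of the two positions, which determines an edge within its tree: the star is
    coloured 1, 2, 3 and the path 1, 2, 1. *)
Definition tree_colour (t : bool) (s : nat) : nat :=
  if t then s else if s == 3 then 2 else 1.

Definition table (rows : seq (seq nat)) (i j : nat) : nat := nth 0 (nth [::] rows i) j.

(* Colours of the K_{4,4} between the positions of two trees; for a pair of
   paths it is [i + j]. *)
Definition cross_colour (t u : bool) (i j : nat) : nat :=
  match t, u with
  | true, true => table [:: [:: 0; 1; 2; 3]; [:: 3; 4; 0; 7]; [:: 1; 8; 5; 0]; [:: 2; 0; 9; 6]] i j
  | true, false => table [:: [:: 0; 1; 2; 3]; [:: 4; 5; 1; 6]; [:: 7; 0; 8; 2]; [:: 1; 2; 3; 9]] i j
  | false, true => table [:: [:: 0; 1; 2; 3]; [:: 4; 5; 1; 6]; [:: 7; 0; 8; 2]; [:: 1; 2; 3; 9]] j i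
  | false, false => i + j
  end.

Lemma all_lt4 (P : nat -> bool) : all P (iota 0 4) -> forall i, i < 4 -> P i.
Proof. by move=> /allP h i i4; apply: h; rewrite mem_iota. Qed.

Lemma tree_colour_proper t i j k : i < 4 -> j < 4 -> k < 4 ->
  tree_adj t i j -> tree_adj t i k -> j != k ->
  tree_colour t (i + j) != tree_colour t (i + k).
Proof.
move=> i4 j4 k4; have : all (fun i => all (fun j => all (fun k =>
  [&& tree_adj t i j, tree_adj t i k & j != k] ==>
  (tree_colour t (i + j) != tree_colour t (i + k))) (iota 0 4)) (iota 0 4)) (iota 0 4).
  by case: t.
by move/all_lt4/(_ i i4)/all_lt4/(_ j j4)/all_lt4/(_ k k4)/implyP => h h1 h2 h3; apply: h;
  rewrite h1 h2.
Qed.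

Lemma cross_colour_inj t u i j k : i < 4 -> j < 4 -> k < 4 -> j != k ->
  (cross_colour t u i j != cross_colour t u i k) && (cross_colour t u j i != cross_colour t u k i).
Proof.
move=> i4 j4 k4; have : all (fun i => all (fun j => all (fun k => (j != k) ==>
  (cross_colour t u i j != cross_colour t u i k) && (cross_colour t u j i != cross_colour t u k i))
  (iota 0 4)) (iota 0 4)) (iota 0 4).
  by case: t; case: u.
by move/all_lt4/(_ i i4)/all_lt4/(_ j j4)/all_lt4/(_ k k4)/implyP.
Qed.

(** The alternatives are the three perfect matchings of the K_4 on one edge of each tree. Between
    two paths the sums [i + j] always agree on a crossing matching. The tables are arranged so that
    crossing colours agree for every pair of tree edges whose own colours differ. *)
Lemma tree_pair_clash t u i i' j j' : i < 4 -> i' < 4 -> j < 4 -> j' < 4 ->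
  tree_adj t i i' -> tree_adj u j j' ->
  [|| tree_colour t (i + i') == tree_colour u (j + j'),
      cross_colour t u i j == cross_colour t u i' j' |
      cross_colour t u i j' == cross_colour t u i' j].
Proof.
move=> i4 i'4 j4 j'4; have : all (fun i => all (fun i' => all (fun j => all (fun j' =>
  tree_adj t i i' && tree_adj u j j' ==>
  [|| tree_colour t (i + i') == tree_colour u (j + j'),
      cross_colour t u i j == cross_colour t u i' j' |
      cross_colour t u i j' == cross_colour t u i' j])
  (iota 0 4)) (iota 0 4)) (iota 0 4)) (iota 0 4).
  by case: t; case: u.
move/all_lt4/(_ i i4)/all_lt4/(_ i' i'4)/all_lt4/(_ j j4)/all_lt4/(_ j' j'4)/implyP => h h1 h2.
by apply: h; rewrite h1 h2.
Qed.

(** Without triangles and 4-cycles a graph on four vertices is a forest, hence contained in a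
    spanning star or path. All 64 graphs are checked; [s] lists the positions given to the
    vertices. *)
Lemma forest4_embed (b : nat -> nat -> bool) :
  (forall i j, b i j = b j i) -> (forall i, ~~ b i i) ->
  (forall i j k, ~~ [&& b i j, b j k & b i k]) ->
  (forall i j k l, uniq [:: i; j; k; l] -> ~~ [&& b i j, b j k, b k l & b l i]) ->
  exists t s, perm_eq s (iota 0 4) /\
    forall i j, i < 4 -> j < 4 -> b i j -> tree_adj t (nth 0 s i) (nth 0 s j).
Proof.
move=> bC birr tri sq.
pose ok t s := [&& b 0 1 ==> tree_adj t (nth 0 s 0) (nth 0 s 1), b 0 2 ==> tree_adj t (nth 0 s 0)
  (nth 0 s 2),
  b 0 3 ==> tree_adj t (nth 0 s 0) (nth 0 s 3), b 1 2 ==> tree_adj t (nth 0 s 1) (nth 0 s 2),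
  b 1 3 ==> tree_adj t (nth 0 s 1) (nth 0 s 3) & b 2 3 ==> tree_adj t (nth 0 s 2) (nth 0 s 3)].
suff [t [s [sP /and5P[o1 o2 o3 o4 /andP[o5 o6]]]]] : exists t s, perm_eq s (iota 0 4) /\ ok t s.
  exists t, s; split=> // i j i4 j4.
  have tC x y : tree_adj t x y = tree_adj t y x.
    by rewrite /tree_adj; case: (t); [rewrite eq_sym|rewrite orbC].
  wlog ij : i j i4 j4 / i <= j.
    by move=> W; case/orP: (leq_total i j) => ij; [exact: W|rewrite bC tC; apply: W].
  case: i ij i4 => [|[|[|[|]]]] //; case: j j4 => [|[|[|[|]]]] //= _ _ _;
    rewrite ?(negPf (birr _)) //; exact/implyP.
suff /hasP[t _ /hasP[s sP okts]] : has (fun t => has (ok t) (permutations (iota 0 4))) [:: true;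
  false].
  by exists t, s; rewrite -mem_permutations.
have := (tri 0 1 2, tri 0 1 3, tri 0 2 3, tri 1 2 3).
have := (sq 0 1 2 3 isT, sq 0 1 3 2 isT, sq 0 2 1 3 isT).
rewrite /ok (bC 3 0) (bC 2 0) (bC 3 2) (bC 2 1).
by case: (b 0 1); case: (b 0 2); case: (b 0 3); case: (b 1 2); case: (b 1 3);
  case: (b 2 3) => -[[? ?] ?] [[[? ?] ?] ?].
Qed.

Lemma edge_other n (E : {set {set 'I_n}}) (e : {set 'I_n}) x :
  is_graph E -> e \in E -> x \in e -> exists2 y, x != y & e = [set x; y].
Proof.
move=> EG eE; have := subsetP EG e eE; rewrite inE => /cards2P[a [b [ab ->]]].
move=> /set2P[->|->]; first by exists b.
by exists a; rewrite 1?eq_sym // setUC.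
Qed.

Lemma edge_neq n (E : {set {set 'I_n}}) x y : is_graph E -> [set x; y] \in E -> x != y.
Proof. by move=> EG /(subsetP EG); rewrite inE cards2; case: (x != y). Qed.

Lemma edges_in_grow n (E : {set {set 'I_n}}) (S A : {set 'I_n}) v k :
  is_graph E -> v \notin S -> k <= #|edges_in E S| -> A \subset S ->
  (forall a, a \in A -> [set v; a] \in E) ->
  k + #|A| <= #|edges_in E (v |: S)|.
Proof.
move=> EG vS kS AS vA; rewrite card_edges_in_setU1 // leq_add //.
by apply: subset_leq_card; apply/subsetP=> a aA; rewrite inE (subsetP AS) ?vA.
Qed.

Lemma triangle_edges_in n (E : {set {set 'I_n}}) x y z : is_graph E ->
  [set x; y] \in E -> [set y; z] \in E -> [set x; z] \in E ->
  exists S : {set 'I_n}, #|S| = 3 /\ 3 <= #|edges_in E S|.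
Proof.
move=> EG xy yz xz.
have [nxy nyz nxz] := And3 (edge_neq EG xy) (edge_neq EG yz) (edge_neq EG xz).
have yx : y \notin [set x] by rewrite inE eq_sym.
have zxy : z \notin y |: [set x] by rewrite !inE negb_or eq_sym nyz eq_sym.
have e1 : 0 + #|[set x]| <= #|edges_in E (y |: [set x])|.
  by apply: edges_in_grow => // a /set1P->; rewrite setUC.
have e2 : 0 + #|[set x]| + #|y |: [set x]| <= #|edges_in E (z |: (y |: [set x]))|.
  by apply: edges_in_grow => // a /setU1P[->|/set1P->]; rewrite setUC.
have cyx : #|y |: [set x]| = 2 by rewrite cardsU1 yx cards1.
exists (z |: (y |: [set x])); split; first by rewrite cardsU1 zxy cyx.
by move: e2; rewrite cyx cards1.
Qed.

Section Forest.
Variables (n : nat) (E : {set {set 'I_n}}).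
Hypotheses (EG : is_graph E) (sE : sparse 5 4 5 E).

(** On 3, 4 and 5 vertices at most 2, 3 and 3 edges are allowed: no triangle, no 4-cycle, no
    connected set of five vertices. *)
Lemma forest_bound (S : {set 'I_n}) : 0 < #|S| <= 5 -> 5 * #|edges_in E S| < 4 * #|S|.
Proof. by move=> h; have := forallP sE S; rewrite h. Qed.

Lemma forest_no_triangle x y z :
  [set x; y] \in E -> [set y; z] \in E -> [set x; z] \in E -> False.
Proof.
move=> xy yz xz; have [S [S3 e3]] := triangle_edges_in EG xy yz xz.
by have := forest_bound (S := S); rewrite S3 => /(_ isT); move: e3; clear; lia.
Qed.

Lemma forest_no_square x y z w : uniq [:: x; y; z; w] ->
  [set x; y] \in E -> [set y; z] \in E -> [set z; w] \in E -> [set w; x] \in E -> False.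
Proof.
rewrite /= !inE !negb_or => /and4P[/and3P[nxy nxz nxw] /andP[nyz nyw] nzw _] xy yz zw wx.
have yx : y \notin [set x] by rewrite inE eq_sym.
have zxy : z \notin y |: [set x] by rewrite !inE negb_or ![z == _]eq_sym nyz nxz.
have wxyz : w \notin z |: (y |: [set x]) by rewrite !inE !negb_or ![w == _]eq_sym nzw nyw nxw.
have e1 : 0 + #|[set x]| <= #|edges_in E (y |: [set x])|.
  by apply: edges_in_grow => // a /set1P->; rewrite setUC.
have e2 : 0 + #|[set x]| + #|[set y]| <= #|edges_in E (z |: (y |: [set x]))|.
  by apply: edges_in_grow => //; [rewrite sub1set setU11|move=> a /set1P->; rewrite setUC].
have e3 : 0 + #|[set x]| + #|[set y]| + #|[set x; z]| <= #|edges_in E (w |: (z |: (y |: [set x])))|.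
  apply: edges_in_grow => //; first by apply/subsetP=> a /set2P[]->; rewrite !inE eqxx ?orbT.
  by move=> a /set2P[]->; rewrite // setUC.
have cS : #|w |: (z |: (y |: [set x]))| = 4 by rewrite !cardsU1 wxyz zxy yx cards1.
have := forest_bound (S := w |: (z |: (y |: [set x]))); rewrite cS => /(_ isT).
by move: e3; rewrite cards2 nxz !cards1; clear; lia.
Qed.

Variable side : 'I_n -> bool.

Definition mono_adj : rel 'I_n := fun x y => ([set x; y] \in E) && (side x == side y).

Lemma mono_adjC : symmetric mono_adj.
Proof. by move=> x y; rewrite /mono_adj setUC eq_sym. Qed.

Definition mono_comp (x : 'I_n) : {set 'I_n} := [set y | connect mono_adj x y].

(** While [S] is not the whole component some edge leaves it, so every added vertex brings at least
    one edge. *)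
Lemma comp_grow x k : k < #|mono_comp x| ->
  exists S : {set 'I_n}, [/\ S \subset mono_comp x, x \in S, #|S| = k.+1 & k <= #|edges_in E S|].
Proof.
elim: k => [_|k IH kx].
  by exists [set x]; rewrite sub1set !inE connect0 eqxx cards1.
have [S [SC xS cS eS]] := IH (ltnW kx).
have [v /andP[vS vC] /exists_inP[u uS uv]] : exists2 v, (v \notin S) && (v \in mono_comp x) &
  [exists u in S, mono_adj u v].
  apply/exists_inP; apply: contraLR kx => /exists_inPn noex.
  rewrite -leqNgt -cS; apply: subset_leq_card; apply/subsetP=> y; rewrite inE => xy.
  have clS : closed mono_adj (mem S).
    apply: (intro_closed (sym_connect_sym mono_adjC)) => u v uv uS.
    apply: contraT => vS; have := noex v; rewrite unfold_in vS inE.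
    have -> : connect mono_adj x v.
      by apply: connect_trans (connect1 uv); have := subsetP SC u uS; rewrite inE.
    by move=> /(_ isT) /exists_inP[]; exists u.
  by have := closed_connect clS xy; rewrite xS => <-.
exists (v |: S); split.
- by rewrite subUset sub1set vC.
- by rewrite inE xS orbT.
- by rewrite cardsU1 vS cS.
- rewrite -addn1 -(cards1 u); apply: edges_in_grow => //; first by rewrite sub1set.
  by move=> a /set1P->; rewrite setUC; case/andP: uv.
Qed.

Lemma card_comp x : #|mono_comp x| <= 4.
Proof.
rewrite leqNgt; apply/negP=> /comp_grow[S [_ _ S5 e4]].
by have := forest_bound (S := S); rewrite S5 => /(_ isT); move: e4; clear; lia.
Qed.

Lemma comp_embed x : exists (t : bool) (pos : 'I_n -> nat),
  [/\ {in mono_comp x &, injective pos}, {in mono_comp x, forall y, pos y < 4} &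
      {in mono_comp x &, forall y z, mono_adj y z -> tree_adj t (pos y) (pos z)}].
Proof.
pose w i := nth x (enum (mono_comp x)) i; pose C := #|mono_comp x|.
pose b i j := [&& i < C, j < C & mono_adj (w i) (w j)].
have w_inj i j : i < C -> j < C -> (w i == w j) = (i == j).
  by move=> iC jC; rewrite nth_uniq -?cardE ?enum_uniq.
have [||i j k|i j k l u|t [s [sP emb]]] := @forest4_embed b.
- by move=> i j; rewrite /b mono_adjC andbCA.
- move=> i; rewrite /b /mono_adj; apply/negP=> /and3P[_ _ /andP[/(edge_neq EG)]].
  by rewrite eqxx.
- apply/negP=> /and3P[/and3P[_ _ /andP[h1 _]] /and3P[_ _ /andP[h2 _]] /and3P[_ _ /andP[h3 _]]].
  exact: forest_no_triangle h1 h2 h3.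
- apply/negP=> /and4P[/and3P[iC jC /andP[h1 _]] /and3P[_ kC /andP[h2 _]] /and3P[_ lC /andP[h3 _]]
  /and3P[_ _ /andP[h4 _]]].
  apply: forest_no_square h1 h2 h3 h4.
  by rewrite /= !inE !w_inj //; move: u; rewrite /= !inE.
have ix y : y \in mono_comp x -> index y (enum (mono_comp x)) < C by rewrite /C cardE index_mem
  mem_enum.
have ix4 y : y \in mono_comp x -> index y (enum (mono_comp x)) < 4.
  by move=> yC; apply: leq_trans (ix y yC) (card_comp x).
have ss : size s = 4 by rewrite (perm_size sP).
have us : uniq s by rewrite (perm_uniq sP).
exists t, (fun y => nth 0 s (index y (enum (mono_comp x)))); split.
- move=> y z yC zC /eqP; rewrite nth_uniq ?ss ?ix4 // => /eqP /index_inj.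
  by move=> /(_ x); apply; rewrite mem_enum.
- move=> y yC; have : nth 0 s (index y (enum (mono_comp x))) \in iota 0 4.
    by rewrite -(perm_mem sP) mem_nth // ss ix4.
  by rewrite mem_iota.
- move=> y z yC zC yz; apply: emb; rewrite ?ix4 // /b !ix //=.
  by rewrite /w !nth_index ?mem_enum.
Qed.
End Forest.

Lemma set2_eq (T : finType) (x y a b : T) :
  x != y -> [set x; y] = [set a; b] -> (x = a /\ y = b) \/ (x = b /\ y = a).
Proof.
move=> xy e; have: x \in [set a; b] by rewrite -e !inE eqxx.
case/set2P=> xa; [left|right]; split=> //.
  by apply: (@set2_inj _ a); rewrite -{1}xa.
by apply: (@set2_inj _ b); rewrite -{1}xa e setUC.
Qed.

Lemma forest_colouring n (E H : {set {set 'I_n}}) (side : 'I_n -> bool) :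
  is_graph E -> sparse 5 4 5 E -> is_graph H ->
  (forall x y, [set x; y] \in H -> side x = side y -> [set x; y] \in E) ->
  exists c, proper_colouring H c /\ ~ has_rainbow_clique 4 H c.
Proof.
move=> EG sE HG HE; pose adj := mono_adj E side.
have adj_sym : connect_sym adj := sym_connect_sym (mono_adjC E side).
have /fin_all_exists[tp tpP] (x : 'I_n) : exists tp : bool * ('I_n -> nat),
    [/\ {in mono_comp E side x &, injective tp.2}, {in mono_comp E side x, forall y, tp.2 y < 4} &
      {in mono_comp E side x &, forall y z, adj y z -> tree_adj tp.1 (tp.2 y) (tp.2 z)}].
  by have [t [pos P]] := comp_embed EG sE side x; exists (t, pos).
pose r x := fingraph.root adj x; pose t x := (tp (r x)).1; pose pos x := (tp (r x)).2 x.
have rC x y : r x = r y -> y \in mono_comp E side (r x).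
  by move=> ->; rewrite inE adj_sym connect_root.
have pos_inj x y : r x = r y -> pos x = pos y -> x = y.
  have [inj _ _] := tpP (r x); rewrite /pos => rxy; rewrite -rxy => /inj; apply; exact: rC.
have pos4 x : pos x < 4 by have [_ p4 _] := tpP (r x); apply/p4/rC.
have adj_r x y : adj x y -> r x = r y by move=> xy; apply/(fingraph.rootP adj_sym)/connect1.
have adj_pos x y : adj x y -> tree_adj (t x) (pos x) (pos y).
  by move=> xy; have [_ _ h] := tpP (r x); have rxy := adj_r _ _ xy; rewrite /pos -rxy; apply: h;
    rewrite ?rC.
(* Edges inside a side use one palette for all trees, because a K_4 may be spoiled by equal colours
   in two different trees. Crossing edges have a separate palette for each ordered pair of
   components. *)
pose g x y : nat + ('I_n * 'I_n * nat) :=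
  if side x == side y then inl (tree_colour (t x) (pos x + pos y))
  else inr (r x, r y, cross_colour (t x) (t y) (pos x) (pos y)).
(* The guard reads a crossing edge from the side [true]; an edge inside a side may be read either
   way, which is harmless by [gC]. *)
pose c e := if [pick xy : 'I_n * 'I_n | (e == [set xy.1; xy.2]) && (side xy.1 || ~~ side xy.2)]
  is Some xy then pickle (g xy.1 xy.2) else 0.
have gC x y : adj x y -> g x y = g y x.
  by move=> xy; rewrite /g eq_sym /t (adj_r _ _ xy) addnC; case/andP: xy => _ /eqP ->; rewrite eqxx.
have cE x y : [set x; y] \in H -> side x || ~~ side y -> c [set x; y] = pickle (g x y).
  move=> xyH sxy; have nxy := edge_neq HG xyH; rewrite /c;
    case: pickP => [[a b] /= /andP[/eqP e sab]|/(_ (x, y))]; last by rewrite /= eqxx sxy.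
  case: (set2_eq nxy e) => -[xa yb]; subst a b => //.
  have syx : side x = side y by move: sxy sab; case: (side x); case: (side y).
  by rewrite (gC y x) // /adj /mono_adj setUC (HE _ _ xyH syx) syx eqxx.
have adjH x y : [set x; y] \in H -> side x = side y -> adj x y.
  by move=> xyH sxy; rewrite /adj /mono_adj HE // sxy eqxx.
exists c; split.
  move=> e1 e2 h1 h2 ne /set0Pn[u]; rewrite inE => /andP[u1 u2].
  have [y uy e1y] := edge_other HG h1 u1; have [z uz e2z] := edge_other HG h2 u2.
  have yz : y != z by apply: contraNneq ne => yz; rewrite e1y e2z yz.
  rewrite {}e1y {}e2z {e1 e2 ne u1 u2} in h1 h2 *.
  have pyz : r y = r z -> pos y != pos z by move=> ryz;
    apply: contraNneq yz => /(pos_inj _ _ ryz) ->.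
  have cE' v w : [set v; w] \in H -> ~~ side v -> side w -> c [set v; w] = pickle (g w v).
    by move=> vwH sv sw; rewrite setUC cE ?sw // setUC.
  have pinj : injective (pickle : nat + ('I_n * 'I_n * nat) -> nat) := pcan_inj pickleK.
  have [suy|suy] := eqVneq (side u) (side y); have [suz|suz] := eqVneq (side u) (side z).
  - rewrite !cE // -?suy -?suz ?orbN // (inj_eq pinj) /g -suy -suz eqxx.
    have ay := adjH _ _ h1 suy; have az := adjH _ _ h2 suz.
    have := tree_colour_proper (pos4 u) (pos4 y) (pos4 z) (adj_pos _ _ ay) (adj_pos _ _ az).
    rewrite pyz; last by rewrite -(adj_r _ _ ay) -(adj_r _ _ az).
    by move=> /(_ isT); apply: contraNneq => -[->].
  - rewrite (cE u y) // -?suy ?orbN //; case su: (side u) suz => suz.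
      by rewrite cE ?su // (inj_eq pinj) /g -suy su eqxx (negPf suz).
    have sz : side z by move: suz; case: (side z).
    by rewrite cE' ?su // (inj_eq pinj) /g -suy su eqxx sz.
  - rewrite (cE u z) // -?suz ?orbN //; case su: (side u) suy => suy.
      by rewrite cE ?su // (inj_eq pinj) /g -suz su eqxx (negPf suy).
    have sy : side y by move: suy; case: (side y).
    by rewrite cE' ?su // (inj_eq pinj) /g -suz su eqxx sy.
  - have eqyz : side y = side z by move: suy suz; case: (side u); case: (side y); case: (side z).
    case su: (side u) suy suz => suy suz.
      rewrite !cE ?su // (inj_eq pinj) /g su (negPf suy) (negPf suz).
      apply/eqP => -[ryz cc];
        have := cross_colour_inj (t u) (t y) (pos4 u) (pos4 y) (pos4 z) (pyz ryz).
      by rewrite cc /t ryz eqxx.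
    have [sy sz] : side y /\ side z by move: suy suz; case: (side y); case: (side z).
    rewrite !cE' ?su // (inj_eq pinj) /g su sy sz /=.
    apply/eqP => -[ryz cc];
      have := cross_colour_inj (t y) (t u) (pos4 u) (pos4 y) (pos4 z) (pyz ryz).
    by rewrite cc /t ryz eqxx andbF.
case=> f [injf [fH rainbow]].
have nofour i j k : i != j -> j != k -> i != k -> side (f i) = side (f j) -> side (f j) = side (f
  k) -> False.
  move=> ij jk ik sij sjk.
  by apply: (forest_no_triangle EG sE (x := f i) (y := f j) (z := f k)); apply: HE;
    rewrite ?fH // sij.
have nopair i j k l : uniq [:: i; j; k;
  l] -> side (f i) -> side (f j) -> ~~ side (f k) -> ~~ side (f l) -> False.
  rewrite /= !inE !negb_or => /and4P[/and3P[ij ik il] /andP[jk jl] kl _] si sj sk sl.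
  have neq a b c' d : a != b -> c' != d -> a != c' -> a != d -> c [set f a; f b] != c [set f c';
    f d].
    move=> ab cd ac ad; apply: rainbow => //; apply: contraNneq ac => e.
    have : f a \in [set f c'; f d] by rewrite -e !inE eqxx.
    by rewrite !inE !(inj_eq injf) (negPf ad) orbF.
  have aij : adj (f i) (f j) by apply: adjH; rewrite ?fH ?si ?sj.
  have akl : adj (f k) (f l) by apply: adjH; rewrite ?fH // (negPf sk) (negPf sl).
  have := tree_pair_clash (pos4 _) (pos4 _) (pos4 _) (pos4 _) (adj_pos _ _ aij) (adj_pos _ _ akl).
  have n1 := neq i j k l ij kl ik il.
  have n2 := neq i k j l ik jl ij il.
  have n3 := neq i l j k il jk ij ik.
  rewrite !cE ?fH ?si ?sj ?sk ?sl ?orbT // in n1 n2 n3.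
  rewrite /g si sj (negPf sk) (negPf sl) /= in n1 n2 n3.
  case/or3P=> /eqP cc.
  - by rewrite cc eqxx in n1.
  - by rewrite /t -(adj_r _ _ aij) -(adj_r _ _ akl) -/(t (f i)) -/(t (f k)) cc eqxx in n2.
  - by rewrite /t -(adj_r _ _ aij) -(adj_r _ _ akl) -/(t (f i)) -/(t (f k)) cc eqxx in n3.
pose o i := @Ordinal 4 i; pose i0 := o 0 isT; pose i1 := o 1 isT; pose i2 := o 2 isT;
  pose i3 := o 3 isT.
case s0: (side (f i0)); case s1: (side (f i1)); case s2: (side (f i2)); case s3: (side (f i3)).
all: first
  [ by apply: (nofour i0 i1 i2); rewrite ?s0 ?s1 ?s2
  | by apply: (nofour i0 i1 i3); rewrite ?s0 ?s1 ?s3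
  | by apply: (nofour i0 i2 i3); rewrite ?s0 ?s2 ?s3
  | by apply: (nofour i1 i2 i3); rewrite ?s1 ?s2 ?s3
  | by apply: (nopair i0 i1 i2 i3); rewrite ?s0 ?s1 ?s2 ?s3
  | by apply: (nopair i0 i2 i1 i3); rewrite ?s0 ?s1 ?s2 ?s3
  | by apply: (nopair i0 i3 i1 i2); rewrite ?s0 ?s1 ?s2 ?s3
  | by apply: (nopair i1 i2 i0 i3); rewrite ?s0 ?s1 ?s2 ?s3
  | by apply: (nopair i1 i3 i0 i2); rewrite ?s0 ?s1 ?s2 ?s3
  | by apply: (nopair i2 i3 i0 i1); rewrite ?s0 ?s1 ?s2 ?s3 ].
Qed.

(** * The perturbed bipartite graph *)

Definition low n (x : 'I_n) : bool := x < n./2.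

Definition bipartite n : {set {set 'I_n}} :=
  [set e in all_edges n | [exists x in e, low x] && [exists x in e, ~~ low x]].

Lemma bipartite_graph n : is_graph (bipartite n).
Proof. by apply/subsetP=> e; rewrite inE => /andP[]. Qed.

Lemma bipartite_side n (x y : 'I_n) : [set x; y] \in bipartite n -> low x != low y.
Proof.
rewrite inE => /and3P[_ /exists_inP[u uxy lu] /exists_inP[v vxy lv]].
by case/set2P: uxy lu => ->; case/set2P: vxy lv => ->; do 2!case: (low _).
Qed.

Lemma card_low n : #|[set x : 'I_n | low x]| = n./2.
Proof.
have hn : n./2 <= n by rewrite -divn2 leq_div.
have winj : injective (widen_ord hn) by move=> i j e; apply/val_inj; exact: (congr1 val e).
rewrite -[RHS]card_ord -cardsT -(card_imset _ winj); apply: eq_card => x.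
rewrite inE; apply/idP/imsetP => [lx|[i _ ->]]; last exact: (ltn_ord i).
by exists (Ordinal lx) => //; apply/val_inj.
Qed.

Lemma card_bipartite n : 'C(n, 2) <= 2 * #|bipartite n|.
Proof.
pose L := [set x : 'I_n | low x].
have cU : n - n./2 = #|~: L|.
  by rewrite cardsCs setCK card_ord card_low.
have inj : {in setX L (~: L) &, injective (fun xy : 'I_n * 'I_n => [set xy.1; xy.2])}.
  move=> [x y] [x' y']; rewrite !inE /= => /andP[lx ly] /andP[lx' ly'] e.
  have xy : x != y by apply: contraNneq ly => <-.
  case: (set2_eq xy e) => -[ex ey]; first by rewrite ex ey.
  by rewrite ey lx' in ly.
have : #|setX L (~: L)| <= #|bipartite n|.
  rewrite -(card_in_imset inj); apply: subset_leq_card.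
  apply/subsetP=> _ /imsetP[[x y] + ->]; rewrite !inE /= => /andP[lx ly].
  rewrite cards2 (_ : x != y); last by apply: contraNneq ly => <-.
  apply/and3P; split=> //; apply/exists_inP; [exists x|exists y] => //; by rewrite !inE eqxx ?orbT.
rewrite cardsX card_low -cU => h.
have b2 : n * n.-1 = 2 * 'C(n, 2) by have := mul_bin_diag n 1; rewrite bin1.
have n2 := odd_double_half n; move: h b2 n2; rewrite -muln2.
move: #|bipartite n| 'C(n, 2) n./2 (odd n) => B C h o; clear.
by case: o; case: n => [|n]; rewrite /=; nia.
Qed.

Lemma is_graphU n (G E : {set {set 'I_n}}) : is_graph G -> is_graph E -> is_graph (G :|: E).
Proof. by rewrite /is_graph subUset => -> ->. Qed.

Lemma bipartiteU_same_side n (E : {set {set 'I_n}}) (x y : 'I_n) :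
  [set x; y] \in bipartite n :|: E -> low x = low y -> [set x; y] \in E.
Proof. by rewrite inE => /orP[/bipartite_side/eqP|]. Qed.

Lemma not_rbw_arrow4 n (E : {set {set 'I_n}}) :
  is_graph E -> sparse 5 4 5 E -> ~ rbw_arrow 4 (bipartite n :|: E).
Proof.
move=> EG sE; have HG := is_graphU (bipartite_graph n) EG.
have [c [pc nr]] := forest_colouring EG sE HG (@bipartiteU_same_side n E).
by move/(_ c pc).
Qed.

Lemma pigeonhole_side l (b : pred 'I_l) k : k.*2 < l ->
  exists (v : bool) (S : {set 'I_l}), #|S| = k.+1 /\ {in S, forall i, b i = v}.
Proof.
move=> kl; pose T v := [set i | b i == v].
have cT : #|T true| + #|T false| = l.
  rewrite -[RHS]card_ord -(cardsC (T true)); congr (_ + _).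
  by apply: eq_card => i; rewrite !inE; case: (b i).
have [v kT] : exists v, k < #|T v|.
  have [h|h] := ltnP k #|T true|; first by exists true.
  by exists false; move: cT kl h; rewrite -addnn; clear; lia.
have /card_gt0P[S] : 0 < #|[set A : {set 'I_l} | A \subset T v & #|A| == k.+1]|.
  by rewrite cards_draws bin_gt0.
rewrite inE => /andP[ST /eqP cS]; exists v, S; split=> // i iS.
by have := subsetP ST i iS; rewrite inE => /eqP.
Qed.

Lemma not_rbw_arrow5 n (E : {set {set 'I_n}}) :
  is_graph E -> sparse 1 1 3 E -> ~ rbw_arrow 5 (bipartite n :|: E).
Proof.
(* No K_5 exists at all, rainbow or not, so any proper colouring will do; an injective one is the
   simplest. *)
move=> EG sE /(_ (fun e => enum_rank e)) [].
  by move=> e1 e2 _ _ ne _; apply: contraNneq ne => /ord_inj/enum_rank_inj ->.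
move=> f [injf [fH _]].
have [v [S [S3 Sv]]] := pigeonhole_side (fun i => low (f i)) (k := 2) isT.
have [i [j [k [ij ik jk eS]]]] := cards3P S3.
have SE a b : a \in S -> b \in S -> a != b -> [set f a; f b] \in E.
  by move=> aS bS ab; apply: bipartiteU_same_side; rewrite ?fH // !Sv.
have [iS jS kS] : [/\ i \in S, j \in S & k \in S] by rewrite eS !inE !eqxx ?orbT.
have [A [A3 e3]] := triangle_edges_in EG (SE _ _ iS jS ij) (SE _ _ jS kS jk) (SE _ _ iS kS ik).
have := forallP sE A; rewrite A3 !mul1n => /implyP/(_ isT).
by rewrite ltnNge e3.
Qed.

Lemma not_rbw_arrow7 n (E : {set {set 'I_n}}) :
  is_graph E -> sparse 7 15 13 E -> ~ rbw_arrow 7 (bipartite n :|: E).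
Proof.
move=> EG sE; have [c [pc nr]] := sparse_no_rainbow_K4 EG sE.
(* Even colours for the random edges and distinct odd ones for all others, so that properness
   reduces to that of [c] on [E]. *)
pose c' e := if e \in E then (c e).*2 else (enum_rank e).*2.+1.
have odd_c' e : odd (c' e) = (e \notin E) by rewrite /c'; case: ifP; rewrite /= odd_double.
move=> /(_ c') [].
  move=> e1 e2 _ _ ne I12.
  have [h1|h1] := boolP (e1 \in E); have [h2|h2] := boolP (e2 \in E).
  - by rewrite /c' h1 h2 (inj_eq double_inj) pc.
  - by apply/eqP=> /(congr1 odd); rewrite !odd_c' h1 h2.
  - by apply/eqP=> /(congr1 odd); rewrite !odd_c' (negPf h1) h2.
  - rewrite /c' (negPf h1) (negPf h2); apply: contraNneq ne => -[] /double_inj.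
    by move=> /ord_inj/enum_rank_inj ->.
move=> f [injf [fH rainbow]].
have [v [S [S4 Sv]]] := pigeonhole_side (fun i => low (f i)) (k := 3) isT.
have pairE e : e \in pairs (f @: S) -> exists i j, [/\ i != j, e = [set f i; f j] & e \in E].
  case/pairsP=> _ [_ [/imsetP[i iS ->] /imsetP[j jS ->] ij ->]].
  have ne : i != j by apply: contraNneq ij => ->.
  exists i, j; split=> //; apply: bipartiteU_same_side; rewrite ?fH // !Sv //.
have QK : clique4 E (f @: S).
  by rewrite /clique4 card_imset // S4; apply/subsetP=> e /pairE[i [j []]].
have [e1 [e2 [h1 h2 ne cc]]] := nr _ QK.
have [i [j [ij e1f e1E]]] := pairE _ h1; have [i' [j' [ij' e2f e2E]]] := pairE _ h2.
have := rainbow i j i' j' ij ij'; rewrite -e1f -e2f => /(_ ne).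
by rewrite /c' e1E e2E cc eqxx.
Qed.

Local Open Scope ring_scope.

(** * Quantitative bounds for the two statements *)

Lemma sum_degrees_ge n (G : {set {set 'I_n}}) : is_graph G ->
  (2 * #|G| <= \sum_v #|[pred u | [set u; v] \in G]|)%N.
Proof.
move=> GG; have -> : (2 * #|G| = \sum_(e in G) \sum_v (v \in e))%N.
  rewrite mulnC -sum_nat_const; apply: eq_bigr => e eG.
  by rewrite -card_sum_mem; have := subsetP GG e eG; rewrite inE => /eqP.
rewrite exchange_big /=; apply: leq_sum => v _.
rewrite -big_mkcondr sum1_card.
apply: leq_trans (leq_imset_card (fun u => [set u; v]) [pred u | [set u; v] \in G]).
apply: subset_leq_card; apply/subsetP => e; rewrite unfold_in => /andP[eG ve].
have [u _ eu] := edge_other GG eG ve.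
by apply/imsetP; exists u; rewrite ?inE -1?eu /= [[set u; v]]setUC -?eu.
Qed.

(** The factor [1 / 2] absorbs the difference between [n ^ 2] and [n * n.-1]. *)
Lemma dense_degrees (R : realFieldType) (d : R) n (G : {set {set 'I_n}}) : (1 < n)%N ->
  0 <= d -> is_graph G -> d * ('C(n, 2))%:R <= (#|G|)%:R ->
  d / 2 * n%:R ^+ 2 <= (\sum_v #|[pred u | [set u; v] \in G]|)%:R.
Proof.
move=> n1 d0 GG dG; apply: le_trans (_ : (2 * #|G|)%:R <= _); last first.
  by rewrite ler_nat sum_degrees_ge.
have b2 : (n * n.-1 = 2 * 'C(n, 2))%N by have := mul_bin_diag n 1; rewrite bin1.
have h : (n ^ 2 <= 2 * (2 * 'C(n, 2)))%N by rewrite -b2; case: n n1 {b2 G GG dG} => [|[|n]] // _;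
  rewrite /=; nia.
rewrite natrM; apply: le_trans (_ : 2 * (d * ('C(n, 2))%:R) <= _); last by rewrite ler_pM2l.
rewrite (_ : d / 2 * n%:R ^+ 2 = d * (n%:R ^+ 2 / 2)); last by ring.
rewrite [leRHS]mulrCA ler_wpM2l //.
rewrite ler_pdivrMr // mulrC -natrX -!natrM ler_nat; exact: h.
Qed.

(** [L] is the ratio of [p] to the threshold [q]. A subgraph with [m >= 1] edges has expected count
    at least [L], since the density bound handles the powers of [n] and [q], and [L ^+ m >= L]. *)
Lemma cross_copies_bound (R : realFieldType) (A B : finType) (e : rel (A + B)%type)
    (s r n : nat) (d p q L : R) (G : {set {set 'I_n}}) (P : pred {set {set 'I_n}})
    (delta := (d / 2) ^+ (#|A| * #|B|) / 2) :
  irreflexive e -> (forall J, (s * #|edges_in (rel_edges e) J| <= r * #|J|)%N) ->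
  (forall (E : {set {set 'I_n}}) (f : A + B -> 'I_n),
     injective f -> edge_map (G :|: E) (cross e) f -> P E) ->
  0 < d -> (1 < n)%N -> is_graph G -> d * ('C(n, 2))%:R <= #|G|%:R ->
  (#|A| + #|B|)%:R ^+ 2 <= delta * n%:R ->
  0 < q -> 1 <= L -> p = q * L -> p <= 1 ->
  (forall k m, (s * m <= r * k)%N -> 1 <= n%:R ^+ k * q ^+ m) ->
  \sum_(E in powerset (all_edges n) | ~~ P E) wt (all_edges n) p E
    <= (#|A| + #|B|).+1%:R ^+ (#|A| + #|B|) / delta ^+ 2 / L.
Proof.
move=> eirr dens arrow d0 n1 GG dG nbig q0 L1 pqL p1 hq.
have n0 := ltnW n1; have L0 := lt_le_trans ltr01 L1.
have p0 : 0 < p by rewrite pqL mulr_gt0.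
have delta0 : 0 < delta by rewrite divr_gt0 ?exprn_gt0 ?divr_gt0.
pose adj : rel 'I_n := fun u v => [set u; v] \in G.
have hD : delta * n%:R ^+ (#|A| + #|B|) <= #|inj_homs A B adj|%:R.
  have := @card_inj_homs_ge R A B 'I_n adj (d / 2); rewrite card_ord; apply=> //.
    by rewrite divr_ge0 // ltW.
  exact: dense_degrees n1 (ltW d0) GG dG.
have DP f : f \in inj_homs A B adj -> injective f /\ (forall a b, [set f (inl a); f (inr b)] \in G).
  rewrite !inE => /andP[/forallP h /injectiveP]; split=> // a b.
  by have /forallP := h a; apply.
rewrite -card_sum in hD *.
rewrite ler_pdivlMr // ler_pdivlMr ?exprn_gt0 //.
rewrite mulrC [_ * L]mulrC mulrA.
have := @copies_second_moment R (A + B)%type 'I_n (all_edges n) (rel_edges e) (inj_homs A B adj) P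
  p L delta.
apply=> //; rewrite ?card_ord ?p0 ?p1 ?(ltW L0) ?(ltW delta0) //.
- by move=> f /DP[injf _]; split=> //; apply: copy_rel_edges_sub.
- move=> E f _ /DP[injf fG] fE; apply: (arrow E f) => // x y; rewrite inE /cross.
  case/orP=> [exy|]; first by rewrite (subsetP fE) ?copy_rel_edges ?orbT.
  by case: x y => [a|b] [a'|b'] // _; rewrite fG.
- move=> J eJ; rewrite pqL exprMn mulrA.
  apply: le_trans (_ : 1 * L ^+ #|edges_in (rel_edges e) J| <= _).
    by rewrite mul1r; case: #|_| eJ => // m _; rewrite exprS ler_peMr ?exprn_ege1 // ltW.
  apply: ler_pM => //; first by rewrite exprn_ge0 ?ltW.
  exact/hq/dens.
Qed.

Lemma sparse_bound (R : realFieldType) (s r K n : nat) (p q L : R) :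
  (0 < n)%N -> (0 < r)%N -> 0 < q -> 0 <= L <= 1 -> p = q * L -> p <= 1 ->
  (forall k m, (r * k <= s * m)%N -> n%:R ^+ k * q ^+ m <= 1) ->
  \sum_(E in powerset (all_edges n) | ~~ sparse s r K E) wt (all_edges n) p E
    <= (K.+1 * 2 ^ (2 ^ K))%:R * L.
Proof.
move=> n0 r0 q0 /andP[L0 L1] pqL p1 hq.
apply: sparse_first_moment; rewrite ?card_ord ?p1 ?pqL ?mulr_ge0 ?(ltW q0) // -?pqL //.
move=> k m /andP[k0 _] rk; rewrite pqL exprMn mulrA.
(* A violating set has an edge, so [L ^+ m <= L]; this gives decay even at the critical density. *)
have m0 : (0 < m)%N.
  by case: m rk => //; rewrite muln0 leqn0 muln_eq0 !eqn0Ngt r0 k0.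
apply: le_trans (_ : 1 * L ^+ m <= _); last first.
  by rewrite mul1r; case: m m0 {rk} => // m _; rewrite exprS ler_piMr // exprn_ile1.
by rewrite ler_wpM2r ?exprn_ge0 // hq.
Qed.

(** * Thresholds *)

From mathcomp Require Import all_classical all_reals all_analysis.
Import numFieldNormedType.Exports.
Local Open Scope classical_set_scope.
Local Open Scope ring_scope.

Lemma prob_perturbedE (R : realType) n (G : {set {set 'I_n}}) (p : R) P :
  prob_perturbed G p P = \sum_(E in powerset (all_edges n) | `[< P (G :|: E) >]) wt (all_edges n)
    p E.
Proof. by rewrite [RHS]big_mkcondr. Qed.

Lemma prob_perturbedC (R : realType) n (G : {set {set 'I_n}}) (p : R) P :
  1 - prob_perturbed G p P = \sum_(E in powerset (all_edges n) | ~~ `[< P (G :|: E) >]) wt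
    (all_edges n) p E.
Proof.
rewrite prob_perturbedE -(sum_wt (all_edges n) p).
by rewrite (bigID (fun E => `[< P (G :|: E) >])) /= [X in X - _]addrC addrK.
Qed.



Lemma one_statement (R : realType) (d : R) (A B : finType) (e : rel (A + B)%type)
    (s r l : nat) (phat p : nat -> R) (G : forall n, {set {set 'I_n}}) :
  0 < d -> irreflexive e ->
  (forall J, (s * #|edges_in (rel_edges e) J| <= r * #|J|)%N) ->
  (forall n (H : {set {set 'I_n}}) (f : A + B -> 'I_n),
     injective f -> edge_map H (cross e) f -> rbw_arrow l H) ->
  (forall n, (0 < n)%N -> 0 < phat n) ->
  (forall n k m, (0 < n)%N -> (s * m <= r * k)%N -> 1 <= n%:R ^+ k * phat n ^+ m) ->
  is_prob_seq p -> (fun n => p n / phat n) @ \oo --> +oo ->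
  (forall n, in_dense_family d (G n)) ->
  (fun n => prob_perturbed (G n) (p n) (@rbw_arrow n l)) @ \oo --> (1 : R).
Proof.
move=> d0 eirr dens arrow ph0 ph1 p01 /cvgryPge Linf Gd.
pose delta : R := (d / 2) ^+ (#|A| * #|B|) / 2.
have delta0 : 0 < delta by rewrite divr_gt0 ?exprn_gt0 ?divr_gt0.
pose K : R := (#|A| + #|B|).+1%:R ^+ (#|A| + #|B|) / delta ^+ 2.
have K0 : 0 <= K by rewrite divr_ge0 ?exprn_ge0 // ltW.
have bound n : (1 < n)%N -> (#|A| + #|B|)%:R ^+ 2 <= delta * n%:R -> 1 <= p n / phat n ->
    1 - prob_perturbed (G n) (p n) (@rbw_arrow n l) <= K / (p n / phat n).
  move=> n1 nbig L1; have n0 := ltnW n1; have [GG dG] := Gd n.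
  rewrite prob_perturbedC.
  apply: (cross_copies_bound (e := e) (s := s) (r := r) (d := d) (q := phat n) (G := G n)) => //.
  - by move=> E f injf fE; apply/asboolP; apply: arrow injf fE.
  - exact: ph0.
  - by rewrite mulrC divfK // gt_eqF ?ph0.
  - by have /andP[] := p01 n.
  - by move=> k m sm; apply: ph1.
apply/cvgrPdist_le => eps eps0.
near=> n.
have n1 : (1 < n)%N by near: n; exact: nbhs_infty_ge.
have nbig : (#|A| + #|B|)%:R ^+ 2 <= delta * n%:R.
  rewrite mulrC -ler_pdivrMr //.
  apply: le_trans (_ : (Num.truncn ((#|A| + #|B|)%:R ^+ 2 / delta)).+1%:R <= _).
    by apply/ltW/truncnS_gt.
  by rewrite ler_nat; near: n; exact: nbhs_infty_ge.
have L1 : 1 <= p n / phat n by near: n; exact: Linf.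
have LK : K / eps <= p n / phat n by near: n; exact: Linf.
have n0 := ltnW n1; have b := bound n n1 nbig L1.
have p1 : 0 <= 1 - prob_perturbed (G n) (p n) (@rbw_arrow n l).
  by rewrite prob_perturbedC; apply: sumr_ge0 => E _; apply: wt_ge0.
rewrite ger0_norm //; apply: le_trans b _.
have L0 : 0 < p n / phat n := lt_le_trans ltr01 L1.
by rewrite ler_pdivrMr // mulrC -ler_pdivrMr.
Unshelve. all: by end_near.
Qed.

Lemma zero_statement (R : realType) (d : R) (s r K l : nat) (phat p : nat -> R) :
  d <= 1 / 2 -> (0 < r)%N ->
  (forall n (E : {set {set 'I_n}}), is_graph E -> sparse s r K E ->
     ~ rbw_arrow l (bipartite n :|: E)) ->
  (forall n, (0 < n)%N -> 0 < phat n) ->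
  (forall n k m, (0 < n)%N -> (r * k <= s * m)%N -> n%:R ^+ k * phat n ^+ m <= 1) ->
  is_prob_seq p -> (fun n => p n / phat n) @ \oo --> (0 : R) ->
  exists G : forall n, {set {set 'I_n}},
    (forall n, in_dense_family d (G n)) /\
    (fun n => prob_perturbed (G n) (p n) (@rbw_arrow n l)) @ \oo --> (0 : R).
Proof.
move=> d2 r0 noarrow ph0 ph1 p01 /cvgrPdist_le L0lim.
exists bipartite; split.
  move=> n; split; first exact: bipartite_graph.
  apply: le_trans (_ : 1 / 2 * ('C(n, 2))%:R <= _); first exact: ler_wpM2r.
  rewrite mulrAC ler_pdivrMr // mul1r mulrC -natrM ler_nat; exact: card_bipartite.
pose C : R := (K.+1 * 2 ^ (2 ^ K))%:R.
have C0 : 0 < C by rewrite ltr0n muln_gt0 /= expn_gt0.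
apply/cvgrPdist_le => eps eps0.
near=> n.
have n0 : (0 < n)%N by near: n; exact: nbhs_infty_ge.
have /andP[pn0 pn1] := p01 n.
have Lge : 0 <= p n / phat n by rewrite divr_ge0 // ltW ?ph0.
have L1 : p n / phat n <= 1.
  by rewrite -(ger0_norm Lge) -normrN -sub0r; near: n; exact: L0lim.
have LC : p n / phat n <= eps / C.
  by rewrite -(ger0_norm Lge) -normrN -sub0r; near: n; apply: L0lim; rewrite divr_gt0.
have q0 : 0 <= prob_perturbed (bipartite n) (p n) (@rbw_arrow n l).
  by rewrite prob_perturbedE; apply: sumr_ge0 => E _; apply: wt_ge0.
rewrite sub0r normrN ger0_norm //.
have hb : \sum_(E in powerset (all_edges n) | ~~ sparse s r K E) wt (all_edges n) (p n) E
    <= C * (p n / phat n).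
  apply: (@sparse_bound R s r K n (p n) (phat n) (p n / phat n)) => //; rewrite ?ph0 ?Lge ?L1 //.
    by rewrite mulrC divfK // gt_eqF ?ph0.
  by move=> k m rk; apply: ph1.
apply: le_trans (_ : C * (p n / phat n) <= _); last by rewrite mulrC -ler_pdivlMr.
apply: le_trans hb.
rewrite prob_perturbedE big_mkcondr [leRHS]big_mkcondr /=; apply: ler_sum => E.
rewrite powersetE => EN; case: asboolP => [arr|_]; last by case: ifP => // _; apply: wt_ge0.
case: (boolP (sparse s r K E)) => [sE|//].
by have := noarrow n E EN sE.
Unshelve. all: by end_near.
Qed.

Lemma expn_powR_mul (R : realType) (alpha : R) n k m : (0 < n)%N ->
  n%:R ^+ k * (n%:R `^ (- alpha)) ^+ m = n%:R `^ (k%:R - alpha * m%:R).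
Proof.
move=> n0; rewrite -!powR_mulrn ?powR_ge0 // -powRrM -powRD ?mulNr //.
by rewrite pnatr_eq0 -lt0n n0 implybT.
Qed.

(** With [alpha = s / r], the exponent [k - alpha * m] has the sign of [r * k - s * m]; both halves
    of the threshold rest on this comparison, in opposite directions. *)
Lemma rbw_threshold_of (R : realType) (d alpha : R) (A B : finType) (e : rel (A + B)%type)
    (s r K l : nat) :
  0 < d -> d <= 1 / 2 -> (0 < r)%N -> alpha * r%:R = s%:R -> irreflexive e ->
  (forall J, (s * #|edges_in (rel_edges e) J| <= r * #|J|)%N) ->
  (forall n (H : {set {set 'I_n}}) (f : A + B -> 'I_n),
     injective f -> edge_map H (cross e) f -> rbw_arrow l H) ->
  (forall n (E : {set {set 'I_n}}), is_graph E -> sparse s r K E ->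
     ~ rbw_arrow l (bipartite n :|: E)) ->
  rbw_threshold d l (fun n => n%:R `^ (- alpha)).
Proof.
move=> d0 d2 r0 ar eirr dens arrow noarrow.
have r0' : 0 < r%:R :> R by rewrite ltr0n.
have ph0 n : (0 < n)%N -> 0 < n%:R `^ (- alpha) :> R by move=> n0; rewrite powR_gt0 // ltr0n.
have scale k m : (k%:R - alpha * m%:R) * r%:R = (r * k)%:R - (s * m)%:R :> R.
  by rewrite !natrM -ar; ring.
split=> [p p01 pinf G Gd|p p01 p0].
  apply: (one_statement (d := d) (e := e) (s := s) (r := r) (phat := fun n => n%:R `^ (- alpha)))
    => //.
  move=> n k m n0 sm; rewrite expn_powR_mul // -[leLHS](powRr0 (n%:R : R)).
  apply: ler_powR; first by rewrite ler1n.
  by rewrite -(pmulr_lge0 _ r0') scale subr_ge0 ler_nat.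
apply: (zero_statement (s := s) (r := r) (K := K) (phat := fun n => n%:R `^ (- alpha))) => //.
move=> n k m n0 rk; rewrite expn_powR_mul // -[leRHS](powRr0 (n%:R : R)).
apply: ler_powR; first by rewrite ler1n.
by rewrite -(pmulr_lle0 _ r0') scale subr_le0 ler_nat.
Qed.

Theorem theorem1p2 (R : realType) (d : R) (hd0 : 0 < d) (hd1 : d <= 1 / 2) :
  rbw_threshold d 4 (fun n => (n%:R : R) `^ (- (5 / 4))) /\
  rbw_threshold d 5 (fun n => (n%:R : R) `^ (- 1)) /\
  rbw_threshold d 7 (fun n => (n%:R : R) `^ (- (7 / 15))).
Proof.
split; [|split].
(* The range [K] of the sparsity is what each colouring needs: 5 vertices to bound the trees, 3 to
   exclude triangles, and 13 to grow clusters of at most 11 vertices by two. *)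
- apply: (rbw_threshold_of (A := 'I_5) (B := 'I_5) (e := stars_rel) (s := 5) (r := 4) (K := 5)) =>
  //; first by rewrite divfK.
  + exact: stars_rel_irr.
  + exact: stars_sparse.
  + exact: rbw_arrow_stars.
  + exact: not_rbw_arrow4.
- apply: (rbw_threshold_of (A := 'I_3) (B := ('I_13 + 'I_13 * 'I_13)%type) (e := @tree_rel 13) (s
  := 1) (r := 1) (K := 3)) => //; first by rewrite mulr1.
  + exact: tree_rel_irr.
  + exact: tree_sparse.
  + by move=> n H f; apply: rbw_arrow_tree.
  + exact: not_rbw_arrow5.
- apply: (rbw_threshold_of (A := ('I_3 + 'I_4)%type)
    (B := ('I_61 + ('I_61 * 'I_61 + 'I_61 * 'I_61 * 'I_61))%type) (e := @two_tree_rel 61)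
    (s := 7) (r := 15) (K := 13)) => //; first by rewrite divfK.
  + exact: two_tree_rel_irr.
  + exact: two_tree_sparse.
  + by move=> n H f; apply: rbw_arrow_two_tree.
  + exact: not_rbw_arrow7.
Qed.
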